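(* Let $T>0$, let $\psi$ be a positive function on $\mathbb{R}^n\times\mathbb{R}^+$, let $w$ be a weight on $\mathbb{R}^n$, and let $1\le p_0<\infty$, $0<\alpha<n$, $1\le p<n/\alpha$, $1/q=1/p-\alpha/n$, with $1\le s<p$ if $1<p<n/\alpha$ and $s=1$ if $p=1$. Let $w_1,w_2$ be weights with $(w_1^s,w_2^s)\in A_{p/s,q/s}$ and $w_2^s\in A_{p/s,q/s}$. Let $S_\alpha$ be a sublinear operator satisfying, with a constant $C$ independent of $f$, $a$, $r$, $$\sup_{x\in B(a,r)}\left|S_\alpha\left(f\cdot\mathcal{X}_{B(a,2r)^c}\right)(x)\right|\le C\sum_{k=1}^\infty(2^{k+1}r)^{-\frac ns+\alpha}\left(\int_{B(a,2^{k+1}r)}|f(y)|^s\,dy\right)^{1/s},\quad (a,r)\in\mathbb{R}^n\times\mathbb{R}^+ .$$ Suppose that two positive functions $\psi_1,\psi_2$ on $\mathbb{R}^n\times\mathbb{R}^+$ satisfy $$\sup_{(a,r)\in\mathbb{R}^n\times\mathbb{R}^+}\frac1{\psi_2(a,r)}\int_r^\infty\frac{\inf_{t\le l<\infty}\psi_1(a,l)\,w_1^p(B(a,l))^{1/p}}{w_2^q(B(a,t))^{1/q}}\frac{dt}t<\infty .$$ Then: (i) if $1<p<n/\alpha$ and $S_\alpha$ is bounded from $L^{p,w_1^p}$ to $L^{q,w_2^q}$, then $S_\alpha$ is bounded from $\mathcal{M}_\psi^{p_0,w}(0,T,\mathcal{M}^{p,w_1^p}_{\psi_1})$ to $\mathcal{M}_\psi^{p_0,w}(0,T,\mathcal{M}^{q,w_2^q}_{\psi_2})$;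 (ii) if $p=1$ and $S_\alpha$ is bounded from $L^{1,w_1}$ to $WL^{q,w_2^q}$, then $S_\alpha$ is bounded from $\mathcal{M}_\psi^{p_0,w}(0,T,\mathcal{M}^{1,w_1}_{\psi_1})$ to $\mathcal{M}_\psi^{p_0,w}(0,T,W\mathcal{M}^{q,w_2^q}_{\psi_2})$.
   Context: Notation: $\mathbb{R}^+=(0,\infty)$; $B(a,r)$ is the open ball in $\mathbb{R}^n$; $\mathcal{X}_E$ is the indicator function of $E$ and $E^c$ its complement. A weight is a nonnegative locally integrable function on $\mathbb{R}^n$ with values in $(0,\infty)$ a.e.; $w(E)=\int_E w(x)\,dx$ and $w^p(E)=\int_E w(x)^p\,dx$. Weight classes: for $1<p<q<\infty$ and $1/p+1/p'=1$, $(w_1,w_2)\in A_{p,q}$ if there is $C>0$ with $\left(\frac1{|B|}\int_B w_2^q\right)^{1/q}\left(\frac1{|B|}\int_B w_1^{-p'}\right)^{1/p'}\le C$ for all balls $B$; for $p=1<q$, $(w_1,w_2)\in A_{1,q}$ if $\left(\frac1{|B|}\int_B w_2^q\right)^{1/q}\|w_1^{-1}\|_{L^\infty(B)}\le C$ for all balls $B$. $w\in A_{p,q}$ means $(w,w)\in A_{p,q}$. Spaces: $\|f\|_{L^{p,w}(E)}=\left(\int_E|f|^pw\right)^{1/p}$ and $\|f\|_{WL^{p,w}(E)}=\sup_{\gamma>0}\gamma\,w(\{x\in E:|f(x)|>\gamma\})^{1/p}$; $L^{p,w}$, $WL^{p,w}$ denote the case $E=\mathbb{R}^n$. For positive $\psi$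 on $\mathbb{R}^n\times\mathbb{R}^+$, $\mathcal{M}^{p,w}_\psi$ and $W\mathcal{M}^{p,w}_\psi$ consist of the measurable $f$ for which respectively $\|f\|_{\mathcal{M}^{p,w}_\psi}=\sup_{a,r}\frac{1}{\psi(a,r)}w(B(a,r))^{-1/p}\|f\|_{L^{p,w}(B(a,r))}$ and $\|f\|_{W\mathcal{M}^{p,w}_\psi}=\sup_{a,r}\frac{1}{\psi(a,r)}w(B(a,r))^{-1/p}\|f\|_{WL^{p,w}(B(a,r))}$ is finite. For $X$ one of these spaces, $\mathcal{M}^{p_0,w}_\psi(0,T,X)$ is the set of functions $f$ on $\mathbb{R}^n\times(0,T)$ with $$\|f\|_{\mathcal{M}^{p_0,w}_\psi(0,T,X)}=\sup_{a\in\mathbb{R}^n,\,r>0,\,t_0\in(0,T)}\frac1{\psi(a,r)}\frac1{w(B(a,r))^{1/p_0}}\left(\int_{(0,T)\cap(t_0-r,t_0+r)}\|f(\cdot,t)\|_X^{p_0}\,dt\right)^{1/p_0}<\infty .$$ The operator acts on functions of $(x,t)$ by acting on $f(\cdot,t)$ for each $t$. An operator $N$ is bounded from $X$ to $Y$ if there is $C>0$ with $\|Nf\|_Y\le C\|f\|_X$ for all $f\in X$. *)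

(* Defs.v *)
From HB Require Import structures.
From mathcomp Require Import all_boot all_order all_algebra.
From mathcomp Require Import all_classical all_reals all_analysis.
From mathcomp Require Import measurable_realfun ess_sup_inf.

Set Implicit Arguments.
Unset Strict Implicit.
Unset Printing Implicit Defensive.
Import Order.TTheory GRing.Theory Num.Theory.
Import numFieldNormedType.Exports.

Local Open Scope classical_set_scope.
Local Open Scope ring_scope.

(* Borel-Lebesgue measure on n-tuples of reals: the point mass for n = 0, and
   the image of (dim 1) x (dim n) under (x, t) |-> x :: t for n.+1. *)
Section tuple_lebesgue.
Local Open Scope ereal_scope.
Context {R : realType}.
Local Notation RR := (measurableTypeR R).

Definition tuple_cons n (z : RR * n.-tuple RR) : n.+1.-tuple RR :=
  [tuple of z.1 :: z.2].

Lemma measurable_tuple_cons n : measurable_fun setT (@tuple_cons n).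
Proof. exact: (measurable_cons measurable_fst measurable_snd). Qed.

Section step.
Variables (n : nat) (m : {sigma_finite_measure set (n.-tuple RR) -> \bar R}).

Definition cons_measure : set (n.+1.-tuple RR) -> \bar R :=
  pushforward ((@lebesgue_measure R) \x m) (@tuple_cons n).

Let cons_measure_measurable A : measurable A ->
  measurable (@tuple_cons n @^-1` A).
Proof.
by move=> mA; rewrite -[X in measurable X]setTI; exact: measurable_tuple_cons.
Qed.

Let cons_measure0 : cons_measure set0 = 0.
Proof. by rewrite /cons_measure /pushforward preimage_set0 measure0. Qed.

Let cons_measure_ge0 A : 0 <= cons_measure A.
Proof. by rewrite /cons_measure /pushforward measure_ge0. Qed.

Let cons_measure_sigma_additive : semi_sigma_additive cons_measure.
Proof.
move=> F mF tF mUF; rewrite /cons_measure /pushforward preimage_bigcup.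
apply: measure_semi_sigma_additive.
- by move=> i; exact: cons_measure_measurable.
- apply/trivIsetP => /= i j _ _ ij; rewrite -preimage_setI.
  by move/trivIsetP : tF => /(_ _ _ _ _ ij) ->//; rewrite preimage_set0.
- by rewrite -preimage_bigcup; exact: cons_measure_measurable.
Qed.

HB.instance Definition _ := isMeasure.Build _ _ _ cons_measure
  cons_measure0 cons_measure_ge0 cons_measure_sigma_additive.

Let cons_measure_sigma_finite : sigma_finite setT cons_measure.
Proof.
have /sigma_finiteP[F [FT ndF Foo]] := sigma_finiteT (@lebesgue_measure R).
have /sigma_finiteP[G [GT ndG Goo]] := sigma_finiteT m.
pose behd (t : n.+1.-tuple RR) : n.-tuple RR := [tuple of behead t].
have mthead : measurable_fun setT (fun t : n.+1.-tuple RR => tnth t ord0).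
  exact: (measurable_tnth (T := RR) ord0).
have mbehd : measurable_fun setT behd by exact: measurable_behead.
pose H k := (fun t : n.+1.-tuple RR => tnth t ord0) @^-1` F k `&`
            behd @^-1` G k.
have HE k : @tuple_cons n @^-1` H k = F k `*` G k.
  apply/seteqP; split=> -[x t] [] /= Fx Gt; split => //=.
    by move: Gt; congr (G k _); exact/val_inj.
  by rewrite (_ : behd _ = t)//; exact/val_inj.
exists H => [|k].
  apply/esym/seteqP; split=> // t _.
  have [i _ Fi] : (\bigcup_i F i) (tnth t ord0) by rewrite -FT.
  have [j _ Gj] : (\bigcup_i G i) (behd t) by rewrite -GT.
  exists (maxn i j) => //; split => /=.
    by move: Fi; apply/subsetPset/ndF/leq_maxl.
  by move: Gj; apply/subsetPset/ndG/leq_maxr.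
have [mFk Fkoo] := Foo k; have [mGk Gkoo] := Goo k; split.
  apply: measurableI; rewrite -[X in measurable X]setTI.
    exact: mthead.
  exact: mbehd.
rewrite /cons_measure /pushforward HE product_measure1E//.
by rewrite lte_mul_pinfty// ge0_fin_numE.
Qed.

HB.instance Definition _ := Measure_isSigmaFinite.Build _ _ _ cons_measure
  cons_measure_sigma_finite.

End step.

Fixpoint tuple_lebesgue n : {sigma_finite_measure set (n.-tuple RR) -> \bar R} :=
  match n with
  | 0 => dirac [tuple]
  | k.+1 => cons_measure (tuple_lebesgue k)
  end.

End tuple_lebesgue.

(* R^n with its Lebesgue sigma-algebra (the completion of the Borel one) and
   Lebesgue measure. *)
Section euclidean_space.
Context {R : realType}.

Definition Rn n : Type := caratheodory_type (tuple_lebesgue (R := R) n)^*%mu.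

HB.instance Definition _ n := Measurable.on (Rn n).

Definition leb n : set (Rn n) -> \bar R :=
  @completed_measure_extension _ _ R (tuple_lebesgue n).

HB.instance Definition _ n := Measure.on (@leb n).

Let leb_sigma_finite n : sigma_finite setT (@leb n).
Proof. exact/completed_measure_extension_sigma_finite/sigma_finiteT. Qed.

HB.instance Definition _ n := Measure_isSigmaFinite.Build _ _ _
  (@leb n) (@leb_sigma_finite n).

(* open Euclidean ball *)
Definition eball n (a : Rn n) (r : R) : set (Rn n) :=
  [set x | Num.sqrt (\sum_(i < n) (tnth x i - tnth a i) ^+ 2) < r].

End euclidean_space.
Arguments Rn : clear implicits.
Arguments leb {R} n.

Section weighted_spaces.
Local Open Scope ereal_scope.
Context {R : realType} {n : nat}.
Local Notation V := (Rn R n).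
Local Notation mu := (@leb R n).
Implicit Types (w : V -> R) (psi : V -> R -> R) (p : R) (E : set V).
Implicit Types (f : V -> \bar R) (X : (V -> \bar R) -> \bar R).

Definition weight w :=
  [/\ measurable_fun setT w, forall x, (0 <= w x)%R,
      {ae mu, forall x, (0 < w x)%R} &
      forall (a : V) (r : R), mu.-integrable (eball a r) (EFin \o w)].

Definition wmeasure w E := \int[mu]_(x in E) (w x)%:E.

Definition average E f := (mu E)^-1 * \int[mu]_(x in E) f x.

(* meant for 1 <= p < q; the norm in the case p = 1 is that of L^oo(B(a,r)) *)
Definition Apq (p q : R) (w1 w2 : V -> R) :=
  let p' := ((1 - p^-1)^-1)%R in
  exists2 C : R, (0 < C)%R & forall (a : V) (r : R), (0 < r)%R ->
    average (eball a r) (fun x => (w2 x `^ q)%:E) `^ q^-1 *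
    (if p == 1%R
     then 'N[mu]_+oo[(fun x => ((w1 x)^-1)%:E) \_ (eball a r)]
     else average (eball a r) (fun x => (w1 x `^ (- p'))%:E) `^ p'^-1)
    <= C%:E.

Definition Lnormw p w E f :=
  (\int[mu]_(x in E) (`|f x| `^ p * (w x)%:E)) `^ p^-1.

Definition WLnormw p w E f :=
  ereal_sup [set c%:E * wmeasure w [set x | E x /\ c%:E < `|f x|] `^ p^-1
            | c in [set c : R | (0 < c)%R]].

Definition Morrey p w psi f :=
  ereal_sup [set (psi a r)^-1%:E *
                 (wmeasure w (eball a r) `^ p^-1)^-1 *
                 Lnormw p w (eball a r) f
            | a in setT & r in [set r : R | (0 < r)%R]].

Definition WMorrey p w psi f :=
  ereal_sup [set (psi a r)^-1%:E *
                 (wmeasure w (eball a r) `^ p^-1)^-1 *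
                 WLnormw p w (eball a r) f
            | a in setT & r in [set r : R | (0 < r)%R]].

Definition timeMorrey p w psi (T : R) X (F : V -> R -> \bar R) :=
  ereal_sup [set z | exists (a : V) (r t0 : R), [/\ (0 < r)%R, (0 < t0 < T)%R &
    z = (psi a r)^-1%:E *
        (wmeasure w (eball a r) `^ p^-1)^-1 *
        (\int[lebesgue_measure]_(t in `]0%R, T[ `&` `](t0 - r)%R, (t0 + r)%R[)
           X (F ^~ t) `^ p) `^ p^-1]].

(* Operators act on real-valued functions and may take infinite values: an
   operator defined through an integral, such as the fractional integral, is
   assigned +oo where that integral does not converge absolutely. *)
Implicit Type S : (V -> R) -> V -> \bar R.

Definition measurable_op S :=
  forall f : V -> R, measurable_fun setT f -> measurable_fun setT (S f).

Definition sublinear S :=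
  (forall f g : V -> R, measurable_fun setT f -> measurable_fun setT g ->
     {ae mu, forall x, `|S (f \+ g)%R x| <= `|S f x| + `|S g x|}) /\
  (forall (c : R) (f : V -> R), measurable_fun setT f ->
     {ae mu, forall x, `|S (c \*o f)%R x| = `|c|%:E * `|S f x|}).

Definition bounded_op S X Y :=
  exists2 C : R, (0 < C)%R & forall f : V -> R,
    measurable_fun setT f -> X (EFin \o f) < +oo ->
    Y (S f) <= C%:E * X (EFin \o f).

(* S acts on f(., t) for each t; the values of f at times outside of (0, T) play
   no role. A jointly measurable f has measurable f(., t) for almost every t. *)
Definition time_bounded_op S p w psi (T : R) X Y :=
  exists2 C : R, (0 < C)%R & forall f : V -> R -> R,
    {ae lebesgue_measure, forall t : R, (0 < t < T)%R ->
      measurable_fun setT (f ^~ t)} ->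
    timeMorrey p w psi T X (fun x t => (f x t)%:E) < +oo ->
    timeMorrey p w psi T Y (fun x t => S (f ^~ t) x) <=
      C%:E * timeMorrey p w psi T X (fun x t => (f x t)%:E).

Definition size_condition S (alpha s : R) :=
  exists2 C : R, (0 < C)%R & forall (f : V -> R) (a : V) (r : R),
    measurable_fun setT f -> (0 < r)%R ->
    ereal_sup [set `|S (f \* \1_(~` eball a (2 * r)))%R x|
              | x in eball a r] <=
    C%:E * \sum_(1 <= k <oo)
      (((2 ^+ k.+1 * r) `^ (- (n%:R / s) + alpha))%:E *
       (\int[mu]_(y in eball a (2 ^+ k.+1 * r)) (`|f y| `^ s)%:E) `^ s^-1).

Definition psi_condition (p q : R) (w1 w2 : V -> R) (psi1 psi2 : V -> R -> R) :=
  ereal_sup [set (psi2 a r)^-1%:E *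
    \int[lebesgue_measure]_(t in `]r, +oo[)
      (ereal_inf [set (psi1 a l)%:E *
                      wmeasure (fun x => w1 x `^ p)%R (eball a l) `^ p^-1
                 | l in `[t, +oo[] /
       wmeasure (fun x => w2 x `^ q)%R (eball a t) `^ q^-1 * (t^-1)%:E)
    | a in setT & r in [set r : R | (0 < r)%R]] < +oo.

End weighted_spaces.

(* Main.v *)
Require Import Defs.
From mathcomp Require Import all_boot all_order all_algebra.
From mathcomp Require Import all_classical all_reals all_analysis.
From mathcomp Require Import measurable_realfun ess_sup_inf ring lra.
Import Order.TTheory GRing.Theory Num.Theory.
Import numFieldNormedType.Exports.

(** Fix a time and consider a function f of the space variable. The heart of the
    matter is the bound, for every ball B = B(a, r),
      |S f|_{L^q(w2^q), B} <= C psi2(a, r) w2^q(B)^(1/q) |f|_{M^p(psi1)},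
    and its weak analogue for p = 1. Since nothing in it depends on the time, it
    is then raised to the power p0 and integrated over the time interval.

    Write N(t) for the norm of f in L^p(w1^p) on B(a, t), and W(t) for
    w2^q(B(a, t))^(1/q). Split f into its restrictions f1 to B(a, 2r) and f2 to
    the complement. By sublinearity, on B one has |S f| <= |S f1| + M almost
    everywhere, with M the supremum of |S f2| on B.
    - The norm of S f1 is at most C N(2r), by the assumed boundedness of S.
    - The size condition bounds M by a sum over dyadic radii t = 2^(k+1) r of
      t^(alpha - n/s) times the L^s norm of f on B(a, t). By Hoelder's inequality
      and the A_{p/s,q/s} condition on (w1^s, w2^s), each term is at most
      C N(t) / W(t) (lemma [Apq_hoelder], rescaled in [Apq_hoelder_scale]).
    The definition of the Morrey norm gives N(t) <= |f|_{M^p(psi1)} G(t), where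
    G(t) is the infimum over l >= t of psi1(a, l) w1^p(B(a, l))^(1/p). The
    integrand of the hypothesis on psi1 and psi2 is G(t) / (t W(t)); as G and W
    are nondecreasing, restricting to the dyadic intervals yields
      sum_k G(2^k r) / W(2^(k+1) r) <= C psi2(a, r)
    (lemma [psi_condition_dyadic]). The shift of the index in W is harmless since
    W(2t) <= C W(t) (lemma [Apq_doubling]). The full series bounds M by
    C psi2(a, r) |f|; the single term k = 1 bounds N(2r) by C psi2(a, r) W(r) |f|.
    Together they give [slice_bounded], for any local norm compatible with a
    decomposition |h| <= |h1| + M. Both the strong and the weak norm are
    ([Lnormw_split], [WLnormw_split]).

    Two points of rigour run through the proof. Nothing says that G is measurable,
    nor that the norm of f(., t) is measurable in t; the integral of a nonnegative
    function is then a supremum over simple functions below it, which is still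
    monotone and positively homogeneous, and this is all that the argument asks of
    it ([ge0_le_integral_ae], [ge0_integralZl_le]). And w1^p is not assumed to be
    locally integrable: that w1^p(B) is finite is a consequence of the condition
    on psi1 and psi2 ([wmeasure_lty_of_psi]). *)

Local Open Scope classical_set_scope.
Local Open Scope ring_scope.
Set Implicit Arguments.
Unset Strict Implicit.

(** * Lebesgue measure of Euclidean balls *)

Section balls.
Context {R : realType}.
Local Notation RR := (measurableTypeR R).

(** Cubes are comparable with balls, and their measure is computed by induction
    on the dimension, directly from the product structure. *)
Definition box n (a : n.-tuple RR) (h : R) : set (n.-tuple RR) :=
  [set x | forall i, `|tnth x i - tnth a i| < h].

Lemma tuple_measurable_leb n (A : set (n.-tuple RR)) :
  measurable A -> measurable (A : set (Rn R n)).
Proof.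
move=> mA; apply: sub_caratheodory; exact: sub_sigma_algebra.
Qed.

Lemma lebE n (A : set (n.-tuple RR)) :
  measurable A -> @leb R n A = tuple_lebesgue n A.
Proof.
move=> mA.
rewrite /leb /completed_measure_extension /= measurable_mu_extE //.
Qed.

Lemma measurable_sqdist n (a : n.-tuple RR) : measurable_fun setT
  (fun x : n.-tuple RR => Num.sqrt (\sum_(i < n) (tnth x i - tnth a i) ^+ 2) : R).
Proof.
apply: (@measurableT_comp _ _ _ _ _ _ (@Num.sqrt R)) => //.
  by apply: continuous_measurable_fun; exact: sqrt_continuous.
apply: measurable_sum => i.
apply: measurable_funX; apply: measurable_funB => //.
exact: measurable_tnth.
Qed.

Lemma measurable_eball n (a : Rn R n) (r : R) : measurable (eball a r).
Proof.
apply: tuple_measurable_leb.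
rewrite -[X in measurable X]setTI.
have := @measurable_sqdist n a measurableT `]-oo, r[%classic (measurable_itv _).
congr (measurable (_ `&` _)).
Qed.

Lemma measurable_box n (a : n.-tuple RR) h : measurable (box a h).
Proof.
rewrite (_ : box a h = \bigcap_(i in [set: 'I_n])
    ((fun x : n.-tuple RR => tnth x i) @^-1` `](tnth a i - h), (tnth a i + h)[)).
  apply: fin_bigcap_measurable => // i _.
  rewrite -[X in measurable X]setTI.
  by apply: measurable_tnth => //; exact: measurable_itv.
by apply/seteqP; split=> x /= bx i => [_|]; have := bx i; rewrite /= in_itv/= -ltr_distlC distrC => // /(_ I).
Qed.

(** A cube in dimension n.+1 is the product of an interval and a cube in
    dimension n, through the map that prepends a coordinate. *)
Lemma tuple_lebesgue_box n (a : n.-tuple RR) (h : R) : 0 < h ->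
  tuple_lebesgue n (box a h) = ((2 * h) ^+ n)%:E.
Proof.
move=> h0; elim: n a => [|n IH] a.
  rewrite /= expr0 diracE mem_set//= => -[]//.
have mb := measurable_box (behead_tuple a) h.
rewrite /= /cons_measure /pushforward.
rewrite (_ : _ @^-1` _ = `](tnth a ord0 - h), (tnth a ord0 + h)[ `*` box (behead_tuple a) h); last first.
  apply/seteqP; split => -[x t] /=.
    move=> bx; split.
      by rewrite in_itv/= -ltr_distlC distrC; have := bx ord0; rewrite {1}/tnth.
    by move=> i; have := bx (lift ord0 i); rewrite !(tnth_nth x) /= nth_behead.
  move=> [xI bt] i.
  case: (unliftP ord0 i) => [j ->|->].
    have := bt j; by rewrite !(tnth_nth x) /= nth_behead.
  by move: xI; rewrite in_itv/= -ltr_distlC distrC tnth0.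
rewrite product_measure1E//.
have leI : @lebesgue_measure R `](tnth a ord0 - h), (tnth a ord0 + h)[%classic = (2 * h)%:E.
  rewrite lebesgue_measure_itv /= lte_fin ifT; last by lra.
  by rewrite -EFinB; congr (_%:E); ring.
by rewrite IH exprS EFinM; congr (_ * _)%E; exact: leI.
Qed.

(** The ball contains the cube of half-side r / (2 n). The constant is crude, but
    only the homogeneity in r matters: the measure of a ball is of order r^n. *)
Lemma leb_eball_ge n (a : Rn R n) (r : R) : (0 < n)%N -> 0 < r ->
  (((n%:R^-1 * r) ^+ n)%:E <= leb n (eball a r))%E.
Proof.
move=> n0 r0.
have nR0 : 0 < (n%:R : R) by rewrite ltr0n.
have h0 : 0 < r / (2 * n%:R) by rewrite divr_gt0// mulr_gt0.
have := tuple_lebesgue_box a h0.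
rewrite (_ : 2 * (r / (2 * n%:R)) = n%:R^-1 * r); last by field; exact: lt0r_neq0.
move=> <-; rewrite -lebE; last exact: measurable_box.
apply: le_measure; rewrite ?inE.
- by apply: tuple_measurable_leb; exact: measurable_box.
- exact: measurable_eball.
move=> x bx; rewrite /eball /=.
have : \sum_(i < n) (tnth x i - tnth a i) ^+ 2 <= \sum_(i < n) (r / (2 * n%:R)) ^+ 2.
  apply: ler_sum => i _; rewrite -[X in X <= _]real_normK ?num_real//.
  apply: lerXn2r; rewrite ?nnegrE //.
    exact: ltW.
  exact/ltW/bx.
rewrite sumr_const card_ord => H.
rewrite -(ger0_norm (ltW r0)) -sqrtr_sqr ltr_sqrt ?exprn_gt0//.
apply: le_lt_trans H _.
have n1 : 1 <= (n%:R : R) by rewrite ler1n.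
have -> : (r / (2 * n%:R)) ^+ 2 *+ n = r ^+ 2 * (4 * n%:R)^-1.
  by rewrite -[LHS]mulr_natr; field; exact: lt0r_neq0.
rewrite ltr_pdivrMr ?mulr_gt0// ltr_pMr ?exprn_gt0//.
by lra.
Qed.

(** The ball lies inside the cube of half-side r. *)
Lemma leb_eball_le n (a : Rn R n) (r : R) : 0 < r ->
  (leb n (eball a r) <= ((2 * r) ^+ n)%:E)%E.
Proof.
move=> r0.
rewrite -(tuple_lebesgue_box a r0) -lebE; last exact: measurable_box.
apply: le_measure; rewrite ?inE.
- exact: measurable_eball.
- by apply: tuple_measurable_leb; exact: measurable_box.
move=> x; rewrite /eball /= => xr i.
apply: le_lt_trans xr.
rewrite -sqrtr_sqr ler_sqrt; last by apply: sumr_ge0 => j _; exact: sqr_ge0.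
rewrite (bigD1 i)//= lerDl; apply: sumr_ge0 => j _; exact: sqr_ge0.
Qed.

Lemma subset_eball n (a : Rn R n) (r1 r2 : R) : r1 <= r2 ->
  eball a r1 `<=` eball a r2.
Proof. by move=> r12 x /= /lt_le_trans; exact. Qed.

End balls.

(** * Hoelder inequalities *)

Section hoelder.
Context d (X : measurableType d) (R : realType).
Variable mu : {measure set X -> \bar R}.
Local Open Scope ereal_scope.

Lemma measurable_fun_powR (f : X -> R) (r : R) : measurable_fun setT f ->
  measurable_fun setT (fun x => f x `^ r)%R.
Proof.
move=> mf; exact: (measurableT_comp (measurable_powR r)).
Qed.

(** The form of Hoelder's inequality in which the exponents appear only as the
    weights l and 1 - l of a geometric mean, so that no conjugate exponent has
    to be carried around. *)
Lemma integral_hoelder (D : set X) (u v : X -> R) (l : R) : measurable D ->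
  measurable_fun setT u -> measurable_fun setT v ->
  (forall x, 0 <= u x)%R -> (forall x, 0 <= v x)%R -> (0 < l < 1)%R ->
  \int[mu]_(x in D) (u x `^ l * v x `^ (1 - l))%:E <=
  (\int[mu]_(x in D) (u x)%:E) `^ l * (\int[mu]_(x in D) (v x)%:E) `^ (1 - l).
Proof.
move=> mD mu_ mv u0 v0 /andP[l0 l1].
have l'0 : (0 < 1 - l)%R by lra.
pose f := ((fun x => u x `^ l) \_ D)%R.
pose g := ((fun x => v x `^ (1 - l)) \_ D)%R.
have mf : measurable_fun setT f.
  by apply/(measurable_restrictT _ _).1 => //; apply: measurable_funTS; exact: measurable_fun_powR.
have mg : measurable_fun setT g.
  by apply/(measurable_restrictT _ _).1 => //; apply: measurable_funTS; exact: measurable_fun_powR.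
have NE (h : X -> R) (k : R) : (0 < k)%R -> (forall x, 0 <= h x)%R ->
    'N[mu]_(k^-1)%:E[EFin \o ((fun x => h x `^ k) \_ D)%R] =
    (\int[mu]_(x in D) (h x)%:E) `^ k.
  move=> k0 h0; rewrite unlock invrK [in RHS]integral_mkcond; congr (_ `^ _).
  apply: eq_integral => x _ /=; rewrite !patchE; case: ifPn => _.
    by rewrite ger0_norm ?powR_ge0// -powRrM divff ?gt_eqF// powRr1.
  by rewrite normr0 powR0// invr_neq0// gt_eqF.
have := hoelder mu mf mg (_ : 0 < l^-1)%R (_ : 0 < (1 - l)^-1)%R.
rewrite !invrK NE// NE// !invr_gt0 Lnorm1 subrKC.
move=> /(_ l0 l'0 erefl); apply: le_trans.
rewrite integral_mkcond le_eqVlt; apply/orP; left; apply/eqP.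
apply: eq_integral => x _ /=; rewrite /f /g !patchE; case: ifPn => _.
  by rewrite ger0_norm// mulr_ge0// powR_ge0.
by rewrite mul0r normr0.
Qed.

End hoelder.

Section dual.
Context d (X : measurableType d) (R : realType).
Variable mu : {measure set X -> \bar R}.
Local Open Scope ereal_scope.

Lemma lee_poweR (x y : \bar R) (r : R) : (0 <= r)%R -> 0 <= x -> x <= y ->
  x `^ r <= y `^ r.
Proof.
move=> r0 x0 xy; apply: gt0_ler_poweR => //; rewrite in_itv/= leey andbT//.
exact: le_trans xy.
Qed.

Lemma measurable_normpow (f : X -> R) (p : R) : measurable_fun setT f ->
  measurable_fun setT (fun x => `|f x| `^ p)%R.
Proof.
move=> mf; apply: measurable_fun_powR.
exact: measurableT_comp (@normr_measurable R setT) mf.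
Qed.

(** Otherwise f would vanish almost everywhere on D, and D would be null. *)
Lemma integral_gt0_ae (D : set X) (f : X -> \bar R) : measurable D ->
  measurable_fun D f -> (forall x, 0 <= f x) -> 0 < mu D ->
  {ae mu, forall x, D x -> 0 < f x} -> 0 < \int[mu]_(x in D) f x.
Proof.
move=> mD mf f0 muD fpos; rewrite lt0e integral_ge0// andbT.
apply/eqP => f_eq0; move: muD; rewrite lt_neqAle => /andP[/eqP + _]; apply.
apply/esym/negligibleP => //; rewrite -[D]setCK -/(almost_everywhere _ _).
have f_ae0 : {ae mu, forall x, D x -> f x = 0}.
  apply: (ae_eq_integral_abs mu mD mf).1; rewrite -[RHS]f_eq0.
  by apply: eq_integral => x _; rewrite gee0_abs.
have := f_ae0; have := fpos; apply: filterS2 => x fx0 fxE Dx.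
by have := fx0 Dx; rewrite fxE// ltxx.
Qed.

Lemma integral_le_measure (D : set X) (g : X -> R) : measurable D ->
  measurable_fun setT g -> (forall x, 0 <= g x <= 1)%R ->
  \int[mu]_(x in D) (g x)%:E <= mu D.
Proof.
move=> mD mg g01; rewrite -[leRHS]mul1e -integral_cst//.
apply: ge0_le_integral => //.
- by move=> x _; rewrite lee_fin; case/andP: (g01 x).
- by apply: measurable_funTS; exact/measurable_EFinP.
- by move=> x _; rewrite lee_fin; case/andP: (g01 x).
Qed.

Lemma integral_powR_indic (D E : set X) (f w : X -> R) (p : R) : p != 0%R ->
  \int[mu]_(x in D) (`|f x * \1_E x| `^ p * w x)%:E =
  \int[mu]_(x in D `&` E) (`|f x| `^ p * w x)%:E.
Proof.
move=> p0; rewrite [RHS]integral_mkcondr; apply: eq_integral => x _.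
rewrite patchE indicE; case: (x \in E); rewrite ?mulr1//.
by rewrite mulr0 normr0 powR0// mul0r.
Qed.

(** Hoelder's inequality against the constant function 1. *)
Lemma integral_powR_Jensen (D : set X) (w : X -> R) (p q : R) : measurable D ->
  measurable_fun setT w -> (forall x, 0 <= w x)%R -> (0 < p < q)%R ->
  \int[mu]_(x in D) (w x `^ p)%:E <=
  (\int[mu]_(x in D) (w x `^ q)%:E) `^ (p / q) * mu D `^ (1 - p / q).
Proof.
move=> mD mw w0 /andP[p0 pq].
have q0 : (0 < q)%R by lra.
have l01 : (0 < p / q < 1)%R by rewrite divr_gt0//= ltr_pdivrMr// mul1r.
have m1 : measurable_fun setT (cst 1%R : X -> R) by [].
have := integral_hoelder mu mD (measurable_fun_powR q mw) m1
  (fun x => powR_ge0 _ _) (fun x => ler01) l01.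
have -> : \int[mu]_(x in D) (cst 1%R x)%:E = mu D by rewrite -[RHS]mul1e -integral_cst.
apply: le_trans.
rewrite le_eqVlt; apply/orP; left; apply/eqP; apply: eq_integral => x _.
by rewrite powR1 mulr1 -powRrM mulrC divfK// lt0r_neq0.
Qed.

Variables (D : set X) (f w : X -> R).
Hypotheses (mD : measurable D) (mf : measurable_fun setT f).
Hypotheses (mw : measurable_fun setT w) (w0 : forall x, (0 <= w x)%R).
Hypothesis (w_pos : {ae mu, forall x, (0 < w x)%R}).

(** The first half of the duality behind the A_{p/s,q/s} condition: |f|^s is the
    product of |f|^s w^s and w^(-s), and the dual exponent of p / s is
    1 / (1 - s / p). The weight may vanish on a null set, where the factorization
    fails, which is why it is used almost everywhere only. *)
Lemma weighted_hoelder (s p : R) : (0 < s < p)%R ->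
  \int[mu]_(x in D) (`|f x| `^ s)%:E <=
  (\int[mu]_(x in D) (`|f x| `^ p * w x `^ p)%:E) `^ (s / p) *
  (\int[mu]_(x in D) (w x `^ s `^ (- (1 - s / p)^-1))%:E) `^ (1 - s / p).
Proof.
move=> /andP[s0 sp].
have p0 : (0 < p)%R by lra.
have l01 : (0 < s / p < 1)%R by rewrite divr_gt0//= ltr_pdivrMr// mul1r.
have mu_ : measurable_fun setT (fun x => `|f x| `^ p * w x `^ p)%R.
  by apply: measurable_funM; [exact: measurable_normpow|exact: measurable_fun_powR].
have mv : measurable_fun setT (fun x => w x `^ s `^ (- (1 - s / p)^-1))%R.
  by apply: measurable_fun_powR; exact: measurable_fun_powR.
have H := integral_hoelder mu mD mu_ mv
  (fun x => mulr_ge0 (powR_ge0 _ _) (powR_ge0 _ _)) (fun x => powR_ge0 _ _) l01.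
apply: le_trans H.
apply: ae_ge0_le_integral => //.
  + by apply: measurable_funTS; apply/measurable_EFinP; exact: measurable_normpow.
  + by move=> x _; rewrite lee_fin mulr_ge0// powR_ge0.
  + apply: measurable_funTS; apply/measurable_EFinP.
    by apply: measurable_funM; exact: measurable_fun_powR.
  + have := w_pos; apply: filterS => x wx _.
    rewrite lee_fin powRM ?powR_ge0// -!powRrM.
    rewrite (_ : p * (s / p) = s)%R; last by field; exact: lt0r_neq0.
    rewrite (_ : s * _ = - s)%R; last first.
      have [s'0 p'0 ps'0] : [/\ s != 0, p != 0 & p - s != 0]%R by split; apply: lt0r_neq0; lra.
      by field; rewrite p'0 ps'0.
    rewrite -mulrA -powRD ?subrr ?powRr0 ?mulr1//.
    by rewrite lt0r_neq0// implybT.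
Qed.

(** The endpoint s = p, where the dual norm of w^(-p) is the one of L^oo. *)
Lemma weighted_hoelder1 (p : R) : (0 < p)%R -> 0 < mu D ->
  \int[mu]_(x in D) (`|f x| `^ p)%:E <=
  (\int[mu]_(x in D) (`|f x| `^ p * w x `^ p)%:E) *
  'N[mu]_+oo[(fun x => ((w x `^ p)^-1)%:E) \_ D].
Proof.
move=> p0 muD.
set F := 'N[mu]_+oo[_].
have muT : 0 < mu setT by apply: (lt_le_trans muD); apply: le_measure; rewrite ?inE.
have F0 : 0 <= F by exact: Lnorm_ge0.
have FE : F = ess_sup mu (abse \o ((fun x => ((w x `^ p)^-1)%:E) \_ D)).
  by rewrite /F unlock muT.
have aeF : {ae mu, forall x, D x -> ((w x `^ p)^-1)%:E <= F}.
  rewrite FE; have := ess_sup_ge mu (abse \o ((fun x => ((w x `^ p)^-1)%:E) \_ D)).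
  apply: filterS => x /= + Dx.
  by rewrite patchE mem_set//= ger0_norm// invr_ge0 powR_ge0.
have mu_ : measurable_fun D (fun x => (`|f x| `^ p * w x `^ p)%:E).
  apply: measurable_funTS; apply/measurable_EFinP.
  by apply: measurable_funM; [exact: measurable_normpow|exact: measurable_fun_powR].
rewrite -ge0_integralZr//; last by move=> x _; rewrite lee_fin mulr_ge0 ?powR_ge0.
apply: ae_ge0_le_integral => //.
- by apply: measurable_funTS; apply/measurable_EFinP; exact: measurable_normpow.
- by move=> x _; rewrite mule_ge0// lee_fin mulr_ge0 ?powR_ge0.
- apply: emeasurable_funM => //.
- have := aeF; have := w_pos; apply: filterS2 => x wx /[swap] Dx /(_ Dx) aex.
  apply: le_trans (_ : (`|f x| `^ p * w x `^ p)%:E * ((w x `^ p)^-1)%:E <= _).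
    by rewrite -EFinM mulfK// lt0r_neq0// powR_gt0.
  by apply: lee_pmul => //; rewrite lee_fin ?mulr_ge0 ?invr_ge0 ?powR_ge0.
Qed.

End dual.

(** * Consequences of the two-weight condition *)

Section Apq_consequences.
Context {R : realType} {n : nat}.
Local Notation V := (Rn R n).
Local Notation mu := (@leb R n).
Hypothesis n0 : (0 < n)%N.
Local Open Scope ereal_scope.

Lemma leb_eball_fin (a : V) (r : R) : (0 < r)%R ->
  exists2 m : R, (0 < m)%R & mu (eball a r) = m%:E.
Proof.
move=> r0.
have fin : mu (eball a r) \is a fin_num.
  by rewrite ge0_fin_numE// (le_lt_trans (leb_eball_le a r0))// ltry.
exists (fine (mu (eball a r))); last by rewrite fineK.
rewrite -lte_fin fineK//; apply: lt_le_trans (leb_eball_ge a n0 r0).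
by rewrite lte_fin exprn_gt0// mulr_gt0// invr_gt0 ltr0n.
Qed.

(** Lets one pass between an average over a set of measure m, as in the
    A_{p,q} condition, and the corresponding integral. *)
Lemma poweR_average (m t : R) (J : \bar R) : (0 < m)%R -> 0 <= J ->
  (m `^ t)%:E * ((m^-1)%:E * J) `^ t = J `^ t.
Proof.
move=> m0 J0; rewrite poweRM ?lee_fin ?invr_ge0 ?(ltW m0)// poweR_EFin muleA.
by rewrite -EFinM -powRM ?invr_ge0 ?(ltW m0)// divff ?gt_eqF// powR1 mul1e.
Qed.

Variables (w1 w2 : V -> R) (s p q : R).
Hypothesis hw1 : weight w1.
Hypotheses (s0 : (0 < s)%R) (sp : (s <= p)%R) (q0 : (0 < q)%R).
Local Notation w1p := (fun x => w1 x `^ p)%R.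
Local Notation w2q := (fun x => w2 x `^ q)%R.

(** The A_{p/s,q/s} condition in the only form in which it is used below. The
    weighted Hoelder inequality bounds the L^s norm of f by its weighted L^p norm
    times the dual norm of w1; multiplying by w2^q(B)^(1/q) makes the product of
    the condition appear. The endpoint s = p is treated by the same statement. *)
Lemma Apq_hoelder :
  Apq (p / s) (q / s) (fun x => w1 x `^ s)%R (fun x => w2 x `^ s)%R ->
  exists2 C : R, (0 < C)%R & forall (a : V) (r : R) (f : V -> R),
    (0 < r)%R -> measurable_fun setT f ->
    (\int[mu]_(y in eball a r) (`|f y| `^ s)%:E) `^ s^-1 *
      wmeasure w2q (eball a r) `^ q^-1 <=
    C%:E * mu (eball a r) `^ (s^-1 - p^-1 + q^-1) *
      Lnormw p w1p (eball a r) (EFin \o f).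
Proof.
have [mw1 w10 w1pos _] := hw1.
have p0 : (0 < p)%R by exact: lt_le_trans sp.
move=> [C C0 HC]; exists (C `^ s^-1)%R; first exact: powR_gt0.
move=> a r f r0 mf.
set B := eball a r.
have mB : measurable B by exact: measurable_eball.
have [m m0] := leb_eball_fin a r0; rewrite -/B => mE.
have {HC} := HC a r r0; rewrite -/B.
set F := (if _ then _ else _).
have F0 : 0 <= F by rewrite /F; case: ifP => _; rewrite ?Lnorm_ge0 ?poweR_ge0.
set I := \int[mu]_(y in B) _.
set W := wmeasure _ B.
set N := \int[mu]_(x in B) (`|f x| `^ p * w1 x `^ p)%:E.
have I0 : 0 <= I by apply: integral_ge0 => x _; rewrite lee_fin powR_ge0.
have W0 : 0 <= W by apply: integral_ge0 => x _; rewrite lee_fin powR_ge0.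
have N0 : 0 <= N by apply: integral_ge0 => x _; rewrite lee_fin mulr_ge0 ?powR_ge0.
have minv : (mu B)^-1 = (m^-1)%:E by rewrite mE inver gt_eqF.
rewrite {1}/average minv.
have -> : \int[mu]_(x in B) (w2 x `^ s `^ (q / s))%:E = W.
  by apply: eq_integral => x _; rewrite -powRrM mulrC divfK// lt0r_neq0.
rewrite invf_div => HC.
have IN : I <= N `^ (s / p) * (m `^ (1 - s / p))%:E * F.
  rewrite /F; case: ifPn => [/eqP|] ps.
    have sEp : s = p.
      by rewrite -[LHS]mul1r -ps divfK// lt0r_neq0.
    rewrite /I sEp divff ?lt0r_neq0// subrr powRr0 mule1 poweRe1//.
    have muB : 0 < mu B by rewrite mE lte_fin.
    exact: weighted_hoelder1.
  have slt : (s < p)%R.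
    rewrite lt_neqAle sp andbT; apply: contra ps => /eqP ->.
    by rewrite divff// lt0r_neq0.
  have J0 : 0 <= \int[mu]_(x in B) (w1 x `^ s `^ (- (1 - s / p)^-1))%:E.
    by apply: integral_ge0 => x _; rewrite lee_fin powR_ge0.
  rewrite -muleA /average minv invrK invf_div (poweR_average _ m0 J0).
  apply: weighted_hoelder => //.
  by rewrite s0 slt.
have key : I * W `^ (s / q) <= C%:E * (m `^ (1 - s / p + s / q))%:E * N `^ (s / p).
  apply: le_trans (lee_wpmul2r (poweR_ge0 _ _) IN) _.
  have -> : W `^ (s / q) = (m `^ (s / q))%:E * ((m^-1)%:E * W) `^ (s / q).
    by rewrite poweR_average.
  have -> : (m `^ (1 - s / p + s / q) = m `^ (1 - s / p) * m `^ (s / q))%R.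
    by rewrite [LHS]powRD// (gt_eqF m0) implybT.
  rewrite EFinM.
  rewrite -[X in X <= _]muleA [F * _]muleCA muleA.
  rewrite [X in _ <= X]muleC.
  have -> : C%:E * ((m `^ (1 - s / p))%:E * (m `^ (s / q))%:E) =
            (m `^ (1 - s / p))%:E * (m `^ (s / q))%:E * C%:E by rewrite muleC.
  rewrite !muleA -[X in X <= _]muleA.
  apply: lee_wpmul2l; last by rewrite muleC.
  by rewrite !mule_ge0 ?lee_fin ?powR_ge0 ?poweR_ge0.
rewrite mE /Lnormw.
have -> : \int[mu]_(x in B) (`|(EFin \o f) x| `^ p * (w1 x `^ p)%:E) = N by [].
have s'0 : (0 <= s^-1)%R by rewrite invr_ge0 ltW.
clearbody I W N; clear IN HC.
have [sn pn qn] : [/\ s != 0, p != 0 & q != 0]%R by split; exact: lt0r_neq0.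
have eW : W `^ q^-1 = (W `^ (s / q)) `^ s^-1.
  by rewrite -[RHS]poweRrM; congr poweR; field; rewrite ?pn ?qn ?sn.
have eN : N `^ p^-1 = (N `^ (s / p)) `^ s^-1.
  by rewrite -[RHS]poweRrM; congr poweR; field; rewrite ?pn ?qn ?sn.
have em : m%:E `^ (s^-1 - p^-1 + q^-1) = (m `^ (1 - s / p + s / q))%:E `^ s^-1.
  by rewrite -poweR_EFin -[RHS]poweRrM; congr poweR; field; rewrite ?pn ?qn ?sn.
rewrite eW eN em -[(C `^ s^-1)%:E]poweR_EFin -!poweRM ?mule_ge0 ?poweR_ge0 ?lee_fin ?powR_ge0 ?(ltW C0)//.
by apply: lee_poweR => //; rewrite mule_ge0 ?poweR_ge0.
Qed.

(** Hoelder's inequality above is tested on f = 1 / (1 + w1): its weighted norm is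
    finite because |f| w1 <= 1, and its L^s norm is positive. *)
Lemma Apq_wmeasure_lty (a : V) (r : R) : (0 < r)%R ->
  Apq (p / s) (q / s) (fun x => w1 x `^ s)%R (fun x => w2 x `^ s)%R ->
  wmeasure w2q (eball a r) < +oo.
Proof.
move=> r0 /Apq_hoelder[C C0 HC].
have [mw1 w10 w1pos _] := hw1.
have p0 : (0 < p)%R by exact: lt_le_trans sp.
have [m m0 mE] := leb_eball_fin a r0.
pose f x := ((1 + w1 x)^-1)%R.
have f0 x : (0 < f x)%R by rewrite invr_gt0; have := w10 x; lra.
have mf : measurable_fun setT f.
  rewrite (_ : f = fun x => (1 + w1 x) `^ (-1))%R; last first.
    by apply/funext => x; rewrite powR_inv1// addr_ge0.
  by apply: measurable_fun_powR; exact: measurable_funD.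
have := HC a r f r0 mf; rewrite mE.
set I := \int[mu]_(x in _) _; set W := wmeasure _ _; set N := Lnormw _ _ _ _ => H.
have mB := measurable_eball a r.
have I0 : 0 < I.
  apply: integral_gt0_ae.
  - exact: mB.
  - by apply: measurable_funTS; apply/measurable_EFinP; exact: measurable_normpow.
  - by move=> x; rewrite lee_fin powR_ge0.
  - by have := m0; rewrite -lte_fin -mE.
  - by apply: aeW => x _; rewrite lte_fin powR_gt0// normr_gt0 gt_eqF.
have N1 : N < +oo.
  rewrite /N /Lnormw; apply: poweR_lty.
  apply: (@le_lt_trans _ _ (mu (eball a r))); last by rewrite mE ltry.
  apply: integral_le_measure; first exact: mB.
    by apply: measurable_funM; [exact: measurable_normpow|exact: measurable_fun_powR].
  move=> x; rewrite mulr_ge0 ?powR_ge0//= -powRM//.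
  have fw : (`|f x| * w1 x <= 1)%R.
    rewrite gtr0_norm// mulrC ler_pdivrMr ?mul1r ?lerDr//.
    by have := w10 x; lra.
  have := ge0_ler_powR (ltW p0) _ _ fw; rewrite powR1; apply; rewrite nnegrE//.
  by rewrite mulr_ge0.
rewrite ltNge leye_eq; apply/eqP => WE; move: H.
rewrite WE poweRyr ?invr_neq0 ?lt0r_neq0// gt0_muley ?poweR_gt0//.
rewrite leye_eq => /eqP HE.
have : C%:E * m%:E `^ (s^-1 - p^-1 + q^-1) * N < +oo.
  by rewrite lte_mul_pinfty// ?mule_ge0 ?poweR_ge0 ?lee_fin ?(ltW C0).
by rewrite HE ltxx.
Qed.

End Apq_consequences.

Section doubling.
Context {R : realType} {n : nat}.
Local Notation V := (Rn R n).
Local Notation mu := (@leb R n).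
Hypothesis n0 : (0 < n)%N.
Local Open Scope ereal_scope.

Lemma wmeasure_gt0 (w : V -> R) (q : R) (a : V) (r : R) : weight w -> (0 < r)%R ->
  0 < wmeasure (fun x => w x `^ q)%R (eball a r).
Proof.
move=> [mw w0 wpos _] r0; have mB := measurable_eball a r.
apply: integral_gt0_ae.
- exact: mB.
- by apply: measurable_funTS; apply/measurable_EFinP; exact: measurable_fun_powR.
- by move=> x; rewrite lee_fin powR_ge0.
- by have [m m0 mE] := leb_eball_fin n0 a r0; have := m0; rewrite -lte_fin -mE.
- by have := wpos; apply: filterS => x wx _; rewrite lte_fin powR_gt0.
Qed.

Lemma wmeasure_eball_le (w : V -> R) (q : R) (a : V) (r1 r2 : R) : weight w -> (r1 <= r2)%R ->
  wmeasure (fun x => w x `^ q)%R (eball a r1) <= wmeasure (fun x => w x `^ q)%R (eball a r2).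
Proof.
move=> [mw w0 wpos _] r12; have mB1 := measurable_eball a r1.
have mB2 := measurable_eball a r2; apply: ge0_subset_integral.
- exact: mB1.
- exact: mB2.
- by apply: measurable_funTS; apply/measurable_EFinP; exact: measurable_fun_powR.
- by move=> x _; rewrite lee_fin powR_ge0.
- exact: subset_eball.
Qed.

(** [Apq_hoelder] with the same weight on both sides, applied on the large ball to
    the indicator of the small one: the left-hand side is |B(a, r)|^(1/s) times
    the root of order q of the mass of the large ball. On the right the exponent p < q is raised to q by
    Jensen's inequality, and the powers of the measures of the two balls cancel up
    to a constant. *)
Lemma Apq_doubling (w : V -> R) (s p q : R) : weight w ->
  (0 < s)%R -> (s <= p)%R -> (p < q)%R ->
  Apq (p / s) (q / s) (fun x => w x `^ s)%R (fun x => w x `^ s)%R ->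
  exists2 C : R, (0 < C)%R & forall (a : V) (r : R), (0 < r)%R ->
    wmeasure (fun x => w x `^ q)%R (eball a (2 * r)) `^ q^-1 <=
    C%:E * wmeasure (fun x => w x `^ q)%R (eball a r) `^ q^-1.
Proof.
move=> hw s0 sp pq hA.
have p0 : (0 < p)%R by lra.
have q0 : (0 < q)%R by lra.
have [mw w0 _ _] := hw.
have [C C0 HC] := Apq_hoelder n0 hw s0 sp q0 hA.
set b := (s^-1 - p^-1 + q^-1)%R in HC.
have b0 : (0 < b)%R.
  have : (p^-1 <= s^-1)%R by rewrite lef_pV2 ?posrE.
  have : (0 < q^-1)%R by rewrite invr_gt0.
  by rewrite /b; lra.
exists (C * ((4 * n%:R) ^+ n) `^ b)%R.
  by rewrite mulr_gt0// powR_gt0// exprn_gt0// mulr_gt0// ltr0n.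
move=> a r r0.
have r20 : (0 < 2 * r)%R by lra.
have [m1 m10 m1E] := leb_eball_fin n0 a r0.
have [m2 m20 m2E] := leb_eball_fin n0 a r20.
have mB1 := measurable_eball a r.
have mB2 := measurable_eball a (2 * r).
have B12 : eball a r `<=` eball a (2 * r) by apply: subset_eball; lra.
have m21 : (m2 <= (4 * n%:R) ^+ n * m1)%R.
  have := leb_eball_le a r20; rewrite m2E lee_fin => /le_trans; apply.
  have := leb_eball_ge a n0 r0; rewrite m1E lee_fin => m1ge.
  apply: le_trans (ler_wpM2l _ m1ge); last first.
    by rewrite exprn_ge0// mulr_ge0.
  rewrite -exprMn le_eqVlt; apply/orP; left; apply/eqP; congr (_ ^+ _)%R.
  by field; rewrite pnatr_eq0 -lt0n.
(* The factor 1 puts f in the form of [integral_powR_indic]. *)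
pose f x := (1 * \1_(eball a r) x)%R : R.
have mf : measurable_fun setT f.
  by apply: measurable_funM => //; exact: measurable_indic.
have {HC} := HC a (2 * r)%R f r20 mf.
have IE : \int[mu]_(y in eball a (2 * r)) (`|f y| `^ s)%:E = m1%:E.
  transitivity (\int[mu]_(y in eball a (2 * r)) (`|f y| `^ s * 1)%:E).
    by apply: eq_integral => x _; rewrite mulr1.
  rewrite integral_powR_indic ?lt0r_neq0// setIidr// -m1E -[RHS]mul1e -integral_cst//.
  by apply: eq_integral => x _; rewrite normr1 powR1 mulr1.
have W10 : 0 <= wmeasure (fun x => w x `^ q)%R (eball a r).
  by apply: integral_ge0 => x _; rewrite lee_fin powR_ge0.
have NW : Lnormw p (fun x => w x `^ p)%R (eball a (2 * r)) (EFin \o f) <=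
    wmeasure (fun x => w x `^ q)%R (eball a r) `^ q^-1 * (m1 `^ (p^-1 - q^-1))%:E.
  rewrite /Lnormw.
  have -> : \int[mu]_(x in eball a (2 * r)) (`|(EFin \o f) x| `^ p * (w x `^ p)%:E) =
      \int[mu]_(x in eball a r) (w x `^ p)%:E.
    rewrite [LHS]integral_powR_indic ?lt0r_neq0// setIidr//.
    by apply: eq_integral => x _; rewrite normr1 powR1 mul1r.
  have pq0 : (0 < p < q)%R by rewrite p0.
  have J := integral_powR_Jensen mu mB1 mw w0 pq0.
  apply: le_trans (lee_poweR _ _ J) _.
  - by rewrite invr_ge0 ltW.
  - by apply: integral_ge0 => x _; rewrite lee_fin powR_ge0.
  have -> : leb n (eball a r) `^ (1 - p / q) = m1%:E `^ (1 - p / q) by rewrite m1E.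
  rewrite poweRM ?poweR_ge0// -!poweRrM -poweR_EFin.
  have -> : (p / q / p = q^-1)%R by field; rewrite !lt0r_neq0.
  have -> // : ((1 - p / q) / p = p^-1 - q^-1)%R by field; rewrite !lt0r_neq0.
rewrite IE m2E => H.
set W2 := wmeasure _ (eball a (2 * r)) in H *.
set W1 := wmeasure _ _ in NW W10 H *; set N := Lnormw _ _ _ _ in NW H.
have W20 : 0 <= W2 by apply: integral_ge0 => x _; rewrite lee_fin powR_ge0.
clearbody W1 W2 N.
have m1s : (0 < m1 `^ s^-1)%R by exact: powR_gt0.
rewrite -(@lee_pmul2l _ (m1 `^ s^-1)%:E)//.
apply: (le_trans H); apply: le_trans (lee_wpmul2l _ NW) _.
  by rewrite mule_ge0 ?poweR_ge0// lee_fin ltW.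
rewrite [W1 `^ _ * _]muleC !muleA poweR_EFin -!EFinM.
apply: lee_wpmul2r; first exact: poweR_ge0.
rewrite lee_fin.
have -> : (m1 `^ s^-1 = m1 `^ b * m1 `^ (p^-1 - q^-1))%R.
  rewrite -powRD; last by rewrite (gt_eqF m10) implybT.
  by congr powR; rewrite /b; lra.
rewrite (_ : (_ * _ * (C * _) = C * ((4 * n%:R) ^+ n * m1) `^ b * m1 `^ (p^-1 - q^-1))%R).
  apply: ler_wpM2r; first exact: powR_ge0.
  apply: ler_wpM2l; first exact: ltW.
  by apply: ge0_ler_powR; rewrite ?nnegrE ?mulr_ge0 ?exprn_ge0 ?mulr_ge0 ?(ltW m10) ?(ltW m20) ?(ltW b0).
rewrite powRM ?exprn_ge0 ?mulr_ge0 ?(ltW m10)//.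
by ring.
Qed.

End doubling.

(** * Integrals of functions that need not be measurable *)

Section lower_integral.
Context d (X : measurableType d) (R : realType).
Variable mu : {measure set X -> \bar R}.
Local Open Scope ereal_scope.
Import HBNNSimple.

(** For functions that need not be measurable the integral is the supremum of the
    integrals of the simple functions below. Setting such a simple function to 0
    on a null set does not change its integral, so an inequality almost everywhere
    suffices for monotonicity. *)
Lemma ge0_le_integral_ae (D : set X) (f g : X -> \bar R) :
  (forall x, D x -> 0 <= f x) -> (forall x, D x -> 0 <= g x) ->
  {ae mu, forall x, D x -> f x <= g x} ->
  \int[mu]_(x in D) f x <= \int[mu]_(x in D) g x.
Proof.
move=> f0 g0 [N [mN N0 fgN]].
rewrite ge0_integralE// ge0_integralE//.
apply: ge_ereal_sup => _ [h /= hf <-].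
have mNC : measurable (~` N) by exact: measurableC.
pose h' := proj_nnsfun h mNC.
have -> : sintegral mu h = sintegral mu h'.
  rewrite -!integralT_nnsfun; apply: ge0_ae_eq_integral => //.
  - exact/measurable_EFinP.
  - exact/measurable_EFinP.
  - by move=> x _; rewrite lee_fin.
  - by move=> x _; rewrite lee_fin.
  exists N; split => // x /=; apply: contra_notP => Nx _.
  by rewrite /h' /= mindicE mem_set// mulr1.
apply: ereal_sup_ubound; exists h' => //= x.
rewrite mindicE; have [|xN] := boolP (x \in ~` N); last first.
  rewrite mulr0 /patch; case: ifPn => // /[1!inE]; exact: g0.
rewrite inE mulr1 => Nx; apply: le_trans (hf x) _.
rewrite /patch; case: ifPn => // /[1!inE] Dx.
by apply: contrapT => fg; apply: Nx; apply: fgN => /(_ Dx).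
Qed.

(** Homogeneity of the supremum over simple functions, again for functions that
    need not be measurable. *)
Lemma ge0_integralZl_le (D : set X) (g : X -> \bar R) (c : R) : (0 < c)%R ->
  (forall x, D x -> 0 <= g x) ->
  \int[mu]_(x in D) (c%:E * g x) <= c%:E * \int[mu]_(x in D) g x.
Proof.
move=> c0 g0; have c'0 : (0 <= c^-1)%R by rewrite invr_ge0 ltW.
rewrite ge0_integralE; last by move=> x Dx; rewrite mule_ge0 ?lee_fin ?(ltW c0) ?g0.
rewrite ge0_integralE//.
apply: ge_ereal_sup => _ [h /= hf <-].
pose h' := scale_nnsfun h c'0.
have -> : sintegral mu h = c%:E * sintegral mu h'.
  rewrite (sintegralrM mu c^-1 h) muleA -EFinM divff ?gt_eqF// mul1e//.
apply: lee_wpmul2l; first by rewrite lee_fin ltW.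
apply: ereal_sup_ubound; exists h' => //= x.
have := hf x; rewrite /patch; case: ifPn => _ hx.
  by rewrite EFinM lee_pdivrMl.
by move: hx; rewrite !lee_fin => hx; rewrite mulr_ge0_le0.
Qed.

End lower_integral.

Section dyadic.
Context {R : realType}.

Lemma ler_sum_nat_drop (c : nat -> R) (m N : nat) : (forall k, 0 <= c k) ->
  \sum_(m <= k < N) c k <= \sum_(0 <= k < N) c k.
Proof.
move=> c0; have [mN|Nm] := leqP m N.
  by rewrite [leRHS](big_cat_nat _ mN)//= lerDr sumr_ge0.
by rewrite big_geq ?sumr_ge0// ltnW.
Qed.

(** The integral is bounded below by that of a step function, constant on the
    dyadic intervals ]2^k r, 2^(k+1) r[. The length of such an interval is half of
    its right end, hence the factor 1 / 2. *)
Lemma dyadic_integral_ge (h : R -> \bar R) (r : R) (c : nat -> R) (N : nat) :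
  0 < r -> (forall t, r < t -> (0 <= h t)%E) -> (forall k, 0 <= c k) ->
  (forall k t, 2 ^+ k * r < t < 2 ^+ k.+1 * r ->
    ((c k / (2 ^+ k.+1 * r))%:E <= h t)%E) ->
  ((\sum_(k < N) c k / 2)%:E <= \int[lebesgue_measure]_(t in `]r, +oo[) h t)%E.
Proof.
move=> r0 h0 c0 ch.
pose I k := `](2 ^+ k * r), (2 ^+ k.+1 * r)[%classic : set R.
pose c' k := c k / (2 ^+ k.+1 * r).
have e0 k : 0 < 2 ^+ k :> R by rewrite exprn_gt0.
have e1 k : 1 <= 2 ^+ k :> R by rewrite exprn_ege1// ler1n.
have c'0 k : 0 <= c' k by rewrite divr_ge0// mulr_ge0// ltW.
have Ir k : I k `<=` `]r, +oo[.
  move=> t; rewrite /I /= !in_itv/= andbT => /andP[+ _]; apply: le_lt_trans.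
  by rewrite ler_peMl// ltW.
have Iuniq j k t : I j t -> I k t -> j = k.
  rewrite /I /= !in_itv/= => /andP[j1 j2] /andP[k1 k2].
  have lt_exp a b : 2 ^+ a * r < t -> t < 2 ^+ b.+1 * r -> (a <= b)%N.
    move=> ta tb; have := lt_trans ta tb; rewrite ltr_pM2r// ltr_eXn2l ?ltr1n//.
  by apply/eqP; rewrite eqn_leq !lt_exp.
have mI k : measurable (I k) by exact: measurable_itv.
have ge0c k t : `]r, +oo[%classic t -> (0%:E <= (c' k * \1_(I k) t)%:E)%E.
  by move=> _; rewrite lee_fin mulr_ge0// indicE ler0n.
have -> : ((\sum_(k < N) c k / 2)%:E =
    \int[lebesgue_measure]_(t in `]r, +oo[) \sum_(k < N) (c' k * \1_(I k) t)%:E)%E.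
  have mc k : measurable_fun `]r, +oo[%classic (fun t : R => (c' k * \1_(I k) t)%:E).
    apply/measurable_EFinP; apply: measurable_funTS.
    by apply: measurable_funM; [exact: measurable_cst|exact: measurable_indic].
  rewrite ge0_integral_sum; last 3 first.
  - exact: measurable_itv.
  - move=> k; exact: (mc k).
  - move=> k; exact: (ge0c k).
  rewrite -sumEFin; apply: eq_bigr => k _.
  under eq_integral do rewrite EFinM.
  rewrite ge0_integralZl_EFin//; last first.
    by apply/measurable_EFinP; apply: measurable_funTS; exact: (measurable_indic (mI k)).
  rewrite integral_indic; last 2 first.
  - exact: measurable_itv.
  - exact: mI.
  rewrite (setIidl (Ir k)).
  have lI : @lebesgue_measure R (I k) = (2 ^+ k * r)%:E.
    rewrite /I lebesgue_measure_itv /= lte_fin ltr_pM2r// ltr_eXn2l ?ltr1n//.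
    by rewrite ltnS leqnn -EFinB exprS; congr (_%:E); ring.
  rewrite [X in (_ * X)%E]lI -EFinM /c' exprS; congr (_%:E); field.
  by rewrite !lt0r_neq0.
apply: ge0_le_integral_ae.
- by move=> t rt; apply: sume_ge0 => k _; exact: ge0c.
- by move=> t /=; rewrite in_itv/= andbT => /h0.
apply: aeW => t; rewrite /= in_itv/= andbT => rt.
have [[k Ikt]|noI] := pselect (exists k : 'I_N, I k t).
  rewrite (bigD1 k)//= big1 ?adde0.
    by rewrite indicE mem_set// mulr1; apply: ch; move: Ikt; rewrite /I /= in_itv.
  move=> j jk; rewrite indicE memNset ?mulr0// => Ijt.
  by move/eqP: jk; apply; apply: val_inj; exact: Iuniq Ijt Ikt.
rewrite big1 ?h0// => k _; rewrite indicE memNset ?mulr0// => Ikt.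
by apply: noI; exists k.
Qed.

End dyadic.

(** * The dyadic form of the condition on psi1 and psi2 *)

Section setting.
Context {R : realType} {n : nat}.
Local Notation V := (Rn R n).
Local Notation mu := (@leb R n).
Hypothesis n0 : (0 < n)%N.
Local Open Scope ereal_scope.

(** The real number w2^q(B(a, r))^(1/q), denoted W(r) in the comments; the
    A_{p/s,q/s} condition makes it finite, see [ball_weightE]. *)
Definition ball_weight (w2 : V -> R) (q : R) (a : V) (r : R) : R :=
  fine (wmeasure (fun x => w2 x `^ q)%R (eball a r) `^ q^-1).

(** The function G(t), the numerator in the condition on psi1 and psi2. *)
Definition tail_inf (p : R) (w1 : V -> R) (psi1 : V -> R -> R) (a : V) (t : R) : \bar R :=
  ereal_inf [set (psi1 a l)%:E *
                 wmeasure (fun x => w1 x `^ p)%R (eball a l) `^ p^-1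
            | l in `[t, +oo[].

Variables (w1 w2 : V -> R) (s p q alpha : R) (psi1 psi2 : V -> R -> R).
Hypotheses (hw1 : weight w1) (hw2 : weight w2).
Hypotheses (s0 : (0 < s)%R) (sp : (s <= p)%R) (pq : (p < q)%R).
Hypothesis hq : (q^-1 = p^-1 - alpha / n%:R)%R.
Hypothesis hA12 : Apq (p / s) (q / s) (fun x => w1 x `^ s)%R (fun x => w2 x `^ s)%R.
Hypothesis hA2 : Apq (p / s) (q / s) (fun x => w2 x `^ s)%R (fun x => w2 x `^ s)%R.
Hypothesis hpsi1 : forall (a : V) (r : R), (0 < r)%R -> (0 < psi1 a r)%R.
Hypothesis hpsi2 : forall (a : V) (r : R), (0 < r)%R -> (0 < psi2 a r)%R.
Local Notation w1p := (fun x => w1 x `^ p)%R.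
Local Notation w2q := (fun x => w2 x `^ q)%R.
Local Notation W := (ball_weight w2 q).
Local Notation G := (tail_inf p w1 psi1).

Let p0 : (0 < p)%R. Proof. exact: lt_le_trans sp. Qed.
Let q0 : (0 < q)%R. Proof. exact: lt_trans pq. Qed.

Lemma ball_weightE (a : V) (r : R) : (0 < r)%R -> wmeasure w2q (eball a r) `^ q^-1 = (W a r)%:E.
Proof.
move=> r0; rewrite /ball_weight fineK// ge0_fin_numE ?poweR_ge0//.
apply: poweR_lty; exact: (Apq_wmeasure_lty n0 hw1 s0 sp q0 a r0 hA12).
Qed.

Lemma ball_weight_gt0 (a : V) (r : R) : (0 < r)%R -> (0 < W a r)%R.
Proof. by move=> r0; rewrite -lte_fin -ball_weightE// poweR_gt0// wmeasure_gt0. Qed.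

Lemma ball_weight_le (a : V) (r1 r2 : R) : (0 < r1)%R -> (r1 <= r2)%R -> (W a r1 <= W a r2)%R.
Proof.
move=> r10 r12; have r20 := lt_le_trans r10 r12.
rewrite -lee_fin -!ball_weightE//; apply: lee_poweR.
- by rewrite invr_ge0 ltW.
- by apply: ltW; exact: wmeasure_gt0.
- exact: wmeasure_eball_le.
Qed.

Lemma ball_weight_doubling : exists2 D : R, (0 < D)%R &
  forall (a : V) (r : R), (0 < r)%R -> (W a (2 * r) <= D * W a r)%R.
Proof.
have [D D0 HD] := Apq_doubling n0 hw2 s0 sp pq hA2.
exists D => // a r r0; have r20 : (0 < 2 * r)%R by rewrite mulr_gt0.
by rewrite -lee_fin EFinM -!ball_weightE//; exact: HD.
Qed.

(** The same inequality with the power of r that occurs in the size condition: the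
    exponent 1/s - 1/p + 1/q of the measure of the ball equals (n/s - alpha) / n. *)
Lemma Apq_hoelder_scale : exists2 K : R, (0 < K)%R &
  forall (a : V) (r : R) (f : V -> R), (0 < r)%R -> measurable_fun setT f ->
    (r `^ (- (n%:R / s) + alpha))%:E *
      (\int[mu]_(y in eball a r) (`|f y| `^ s)%:E) `^ s^-1 * (W a r)%:E <=
    K%:E * Lnormw p w1p (eball a r) (EFin \o f).
Proof.
have [C C0 HC] := Apq_hoelder n0 hw1 s0 sp q0 hA12.
set b := (s^-1 - p^-1 + q^-1)%R in HC.
have nR0 : (0 < n%:R :> R)%R by rewrite ltr0n.
have b0 : (0 < b)%R.
  have : (p^-1 <= s^-1)%R by rewrite lef_pV2 ?posrE.
  have : (0 < q^-1)%R by rewrite invr_gt0.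
  by rewrite /b; lra.
have bE : (- (n%:R / s) + alpha = - (n%:R * b))%R.
  by rewrite /b hq; field; rewrite ?lt0r_neq0.
exists (C * 2 `^ (n%:R * b))%R; first by rewrite mulr_gt0// powR_gt0.
move=> a r f r0 mf.
have := HC a r f r0 mf.
rewrite [X in _ * X <= _](ball_weightE a r0).
set I := (\int[mu]_(_ in _) _) `^ _; set N := Lnormw _ _ _ _.
have [m m0 mE] := leb_eball_fin n0 a r0.
have I0 : 0 <= I by exact: poweR_ge0.
have N0 : 0 <= N by exact: poweR_ge0.
rewrite mE poweR_EFin; clearbody I N => H.
rewrite -muleA; apply: le_trans (lee_wpmul2l _ H) _; first by rewrite lee_fin powR_ge0.
rewrite !muleA; apply: lee_wpmul2r => //; rewrite -!EFinM lee_fin.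
have mb : (m `^ b <= 2 `^ (n%:R * b) * r `^ (n%:R * b))%R.
  rewrite -powRM ?(ltW r0)// powRrM powR_mulrn ?mulr_ge0 ?(ltW r0)//.
  apply: ge0_ler_powR; rewrite ?nnegrE ?exprn_ge0 ?mulr_ge0 ?(ltW r0) ?(ltW m0) ?(ltW b0)//.
  by have := leb_eball_le a r0; rewrite mE lee_fin.
rewrite bE powRN -mulrA mulrC ler_pdivrMr ?powR_gt0// -mulrA.
by apply: ler_wpM2l => //; exact: ltW.
Qed.

Hypothesis hpsi12 : psi_condition p q w1 w2 psi1 psi2.

Lemma tail_inf_ge0 (a : V) (t : R) : (0 < t)%R -> 0 <= G a t.
Proof.
move=> t0; apply: le_ereal_inf_tmp => _ [l /= + <-].
rewrite in_itv/= andbT => tl; rewrite mule_ge0 ?poweR_ge0// lee_fin ltW//.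
by apply: hpsi1; exact: lt_le_trans tl.
Qed.

Lemma tail_inf_le (a : V) (t1 t2 : R) : (t1 <= t2)%R -> G a t1 <= G a t2.
Proof.
move=> t12; apply: le_ereal_inf_tmp => _ [l /= + <-].
rewrite in_itv/= andbT => tl; apply: ereal_inf_lbound; exists l => //=.
by rewrite in_itv/= andbT (le_trans t12).
Qed.

(** Both G and W are nondecreasing, so on ]2^k r, 2^(k+1) r[ the integrand
    G(t) / (W(t) t) is at least G(2^k r) / (W(2^(k+1) r) 2^(k+1) r). The statement
    is about real minorants g k of G(2^k r), because at this point G may still be
    infinite. *)
Lemma psi_condition_dyadic : exists2 K : R, (0 < K)%R &
  forall (a : V) (r : R) (g : nat -> R) (N : nat), (0 < r)%R ->
    (forall k, 0 <= g k)%R -> (forall k, (g k)%:E <= G a (2 ^+ k * r)) ->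
    (\sum_(k < N) g k / W a (2 ^+ k.+1 * r) <= K * psi2 a r)%R.
Proof.
move: hpsi12; rewrite /psi_condition; set M := ereal_sup _ => Moo.
(* The maximum with 1 makes the constant positive; the factor 2 compensates the
   1 / 2 of the dyadic bound. *)
exists (2 * Num.max (fine M) 1)%R; first by rewrite mulr_gt0// lt_max ltr01 orbT.
move=> a r g N r0 g0 gG.
have e0 k : (0 < 2 ^+ k * r :> R)%R by rewrite mulr_gt0// exprn_gt0.
pose h t := G a t / wmeasure w2q (eball a t) `^ q^-1 * (t^-1)%:E.
have hW t : (0 < t)%R -> h t = G a t * (W a t)^-1%:E * (t^-1)%:E.
  by move=> t0; rewrite /h (ball_weightE _ t0) inver gt_eqF// ball_weight_gt0.
have h0 t : (r < t)%R -> 0 <= h t.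
  move=> rt; have t0 := lt_trans r0 rt; rewrite hW//.
  by rewrite !mule_ge0 ?tail_inf_ge0// lee_fin invr_ge0 ltW// ball_weight_gt0.
have c0 k : (0 <= g k / W a (2 ^+ k.+1 * r))%R.
  by rewrite divr_ge0// ltW// ball_weight_gt0.
have ch k t : (2 ^+ k * r < t < 2 ^+ k.+1 * r)%R ->
    (g k / W a (2 ^+ k.+1 * r) / (2 ^+ k.+1 * r))%:E <= h t.
  move=> /andP[kt tk]; have t0 := lt_trans (e0 k) kt; rewrite hW// !EFinM.
  have Wt := ball_weight_gt0 a t0.
  apply: lee_pmul.
  - by rewrite -EFinM lee_fin.
  - by rewrite lee_fin invr_ge0 ltW.
  - apply: lee_pmul.
    + by rewrite lee_fin.
    + by rewrite lee_fin invr_ge0 ltW// ball_weight_gt0.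
    + by apply: le_trans (gG k) _; apply: tail_inf_le; exact: ltW.
    + by rewrite lee_fin lef_pV2 ?posrE ?ball_weight_gt0//; apply: ball_weight_le => //; exact: ltW.
  - by rewrite lee_fin lef_pV2 ?posrE// ltW.
have := dyadic_integral_ge N r0 h0 c0 ch.
set J := (\int[lebesgue_measure]_(_ in _) _) => cJ.
have JM : (psi2 a r)^-1%:E * J <= M.
  by apply: ereal_sup_ubound; exists a => //; exists r.
have J0 : 0 <= J.
  apply: integral_ge0 => t /=; rewrite in_itv/= andbT; exact: h0.
have psi20 := hpsi2 a r0.
have M0 : 0 <= M by apply: le_trans JM; rewrite mule_ge0// lee_fin invr_ge0 ltW.
have Mfin : M = (fine M)%:E by rewrite fineK// ge0_fin_numE.
move: JM; rewrite lee_pdivrMl// Mfin -EFinM => /(le_trans cJ).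
rewrite lee_fin -mulr_suml ler_pdivrMr// => /le_trans; apply.
have : (fine M <= Num.max (fine M) 1)%R by rewrite le_max lexx.
move: psi20; set y := psi2 a r; set z := Num.max _ _; nra.
Qed.

(** Were G(t) infinite, the minorant g 0 could be taken arbitrarily large in the
    dyadic bound. *)
Lemma tail_inf_lty (a : V) (t : R) : (0 < t)%R -> G a t < +oo.
Proof.
move=> t0; rewrite ltNge leye_eq; apply/eqP => GE.
have [K K0 HK] := psi_condition_dyadic.
have W0 : (0 < W a (2 ^+ 1 * t))%R by apply: ball_weight_gt0; rewrite mulr_gt0.
have psi20 := hpsi2 a t0.
pose m := ((K * psi2 a t + 1) * W a (2 ^+ 1 * t))%R.
have m0 : (0 <= m)%R by rewrite mulr_ge0 ?addr_ge0 ?mulr_ge0 ?ltW.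
pose g (k : nat) := if k == 0%N then m else 0%R.
have g0 k : (0 <= g k)%R by rewrite /g; case: ifP.
have gG k : (g k)%:E <= G a (2 ^+ k * t).
  rewrite /g; case: ifPn => [/eqP ->|_]; first by rewrite expr0 mul1r GE leey.
  by apply: tail_inf_ge0; rewrite mulr_gt0 ?exprn_gt0.
have := HK a t g 1%N t0 g0 gG; rewrite big_ord1 /= /g /= /m mulfK ?gt_eqF//.
by rewrite -subr_ge0; lra.
Qed.

(** The infimum G(r) being finite, w1^p has finite mass on some ball B(a, l) with
    l >= r. *)
Lemma wmeasure_lty_of_psi (a : V) (r : R) : (0 < r)%R ->
  wmeasure w1p (eball a r) < +oo.
Proof.
move=> r0; have := tail_inf_lty a r0; rewrite /tail_inf => /ereal_inf_lt[_ [l /= + <-]].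
rewrite in_itv/= andbT => rl; have l0 := lt_le_trans r0 rl => H.
apply: le_lt_trans (wmeasure_eball_le p a hw1 rl) _.
rewrite ltNge leye_eq; apply/eqP => wE; move: H.
by rewrite wE poweRyr ?invr_neq0 ?gt_eqF// gt0_muley ?ltxx// lte_fin hpsi1.
Qed.

Lemma Lnormw_eball_le (f : V -> R) (a : V) (r1 r2 : R) : measurable_fun setT f ->
  (r1 <= r2)%R ->
  Lnormw p w1p (eball a r1) (EFin \o f) <= Lnormw p w1p (eball a r2) (EFin \o f).
Proof.
move=> mf r12; have [mw1 w10 _ _] := hw1.
have mB1 := measurable_eball a r1; have mB2 := measurable_eball a r2.
apply: lee_poweR; first by rewrite invr_ge0 ltW.
  by apply: integral_ge0 => x _; rewrite mule_ge0 ?poweR_ge0// lee_fin powR_ge0.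
apply: ge0_subset_integral.
- exact: mB1.
- exact: mB2.
- apply: measurable_funTS; apply/measurable_EFinP.
  by apply: measurable_funM; [exact: measurable_normpow|exact: measurable_fun_powR].
- by move=> x _; rewrite mule_ge0 ?poweR_ge0// lee_fin powR_ge0.
- exact: subset_eball.
Qed.

(** The norm on B(a, t) is at most the one on each larger ball B(a, l), which the
    Morrey norm controls; one then takes the infimum over l. The finiteness of
    w1^p(B(a, l)) is essential: a ball of infinite mass would contribute 0 to the
    Morrey norm, whatever f is. *)
Lemma Lnormw_le_tail_inf (f : V -> R) (X : R) (a : V) (t : R) :
  measurable_fun setT f -> (0 <= X)%R -> Morrey p w1p psi1 (EFin \o f) = X%:E ->
  (0 < t)%R ->
  Lnormw p w1p (eball a t) (EFin \o f) <= X%:E * G a t.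
Proof.
move=> mf X0 XE t0.
have bnd l : (t <= l)%R -> Lnormw p w1p (eball a t) (EFin \o f) <=
    X%:E * ((psi1 a l)%:E * wmeasure w1p (eball a l) `^ p^-1).
  move=> tl; have l0 := lt_le_trans t0 tl.
  apply: le_trans (Lnormw_eball_le a mf tl) _.
  have v0 : 0 < wmeasure w1p (eball a l) `^ p^-1.
    by apply: poweR_gt0; exact: wmeasure_gt0.
  have voo : wmeasure w1p (eball a l) `^ p^-1 < +oo.
    by apply: poweR_lty; exact: wmeasure_lty_of_psi.
  have : (psi1 a l)^-1%:E * (wmeasure w1p (eball a l) `^ p^-1)^-1 *
      Lnormw p w1p (eball a l) (EFin \o f) <= X%:E.
    by rewrite -XE; apply: ereal_sup_ubound; exists a => //; exists l.
  set N := Lnormw _ _ _ _; set v := wmeasure _ _ `^ _ in v0 voo *.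
  have vE : v = (fine v)%:E by rewrite fineK// ge0_fin_numE// ltW.
  have fv0 : (0 < fine v)%R by rewrite -lte_fin -vE.
  have psi10 := hpsi1 a l0.
  rewrite vE inver gt_eqF// -EFinM -invfM lee_pdivrMl ?mulr_gt0//.
  by rewrite muleC EFinM.
have := X0; rewrite le_eqVlt => /orP[/eqP X00|Xpos].
  by have := bnd t (lexx t); rewrite -X00 !mul0e.
rewrite -lee_pdivrMl//; apply: le_ereal_inf_tmp => _ [l /= + <-].
by rewrite in_itv/= andbT => /bnd; rewrite lee_pdivrMl.
Qed.

(** Combines the dyadic bound with the bound of the norms by G, for the sequence
    c k = G(2^k r) / W(2^(k+1) r). *)
Lemma Lnormw_dyadic_le : exists2 K : R, (0 < K)%R &
  forall (f : V -> R) (X : R) (a : V) (r : R), measurable_fun setT f ->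
    (0 <= X)%R -> Morrey p w1p psi1 (EFin \o f) = X%:E -> (0 < r)%R ->
    exists c : nat -> R, [/\ forall k, (0 <= c k)%R,
      forall N, (\sum_(0 <= k < N) c k <= K * psi2 a r)%R &
      forall k, Lnormw p w1p (eball a (2 ^+ k * r)) (EFin \o f) <=
        (X * (c k * W a (2 ^+ k.+1 * r)))%:E].
Proof.
have [K K0 HK] := psi_condition_dyadic.
exists K => // f X a r mf X0 XE r0.
have e0 k : (0 < 2 ^+ k * r)%R by rewrite mulr_gt0// exprn_gt0.
have W0 k : (0 < W a (2 ^+ k * r))%R by exact: ball_weight_gt0.
have [g gE] : exists g : nat -> R, forall k, G a (2 ^+ k * r) = (g k)%:E.
  exists (fun k => fine (G a (2 ^+ k * r))) => k.
  by rewrite fineK// ge0_fin_numE ?tail_inf_lty// tail_inf_ge0.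
have g0 k : (0 <= g k)%R by rewrite -lee_fin -gE; exact: tail_inf_ge0.
exists (fun k => g k / W a (2 ^+ k.+1 * r))%R; split.
- by move=> k; rewrite divr_ge0// ltW.
- move=> N; rewrite big_mkord; apply: (HK a r g N r0 g0) => k.
  by rewrite gE.
- move=> k; rewrite divfK ?gt_eqF// EFinM -gE.
  exact: Lnormw_le_tail_inf.
Qed.

(** The term k = 1 of the dyadic sum alone, together with two doublings to come
    back from the ball of radius 4 r to the one of radius r. *)
Lemma Lnormw_local_le : exists2 A : R, (0 < A)%R &
  forall (f : V -> R) (X : R) (a : V) (r : R), measurable_fun setT f ->
    (0 <= X)%R -> Morrey p w1p psi1 (EFin \o f) = X%:E -> (0 < r)%R ->
    Lnormw p w1p (eball a (2 * r)) (EFin \o f) <=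
      (A * (X * (psi2 a r * W a r)))%:E.
Proof.
have [K K0 HK] := Lnormw_dyadic_le.
have [D D0 HD] := ball_weight_doubling.
exists (K * D ^+ 2)%R; first by rewrite mulr_gt0// exprn_gt0.
move=> f X a r mf X0 XE r0.
have [c [c0 csum /(_ 1%N)]] := HK f X a r mf X0 XE r0.
rewrite expr1 => /le_trans; apply; rewrite lee_fin.
have r20 : (0 < 2 * r)%R by rewrite mulr_gt0.
have W4 : (W a (2 ^+ 2 * r) <= D ^+ 2 * W a r)%R.
  rewrite expr2 -mulrA; apply: le_trans (HD a _ r20) _.
  by rewrite expr2 -mulrA; apply: ler_wpM2l; [exact: ltW|exact: HD].
have W40 : (0 < W a (2 ^+ 2 * r))%R by apply: ball_weight_gt0; rewrite mulr_gt0// exprn_gt0.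
have c1 : (c 1%N <= K * psi2 a r)%R.
  by apply: le_trans (csum 2%N); rewrite big_nat_recl//= big_nat1 lerDr.
have := ler_pM (c0 1%N) (ltW W40) c1 W4.
have := c0 1%N; move: X0 W4 => {csum c0 c1 HD HK XE mf f}.
move: (c 1%N) (W a (2 ^+ 2 * r))%R (W a r) (psi2 a r) => c1 v4 v y X0 _ c10 H.
rewrite (_ : (K * _ * _ = X * (K * y * (D ^+ 2 * v)))%R); last by ring.
exact: ler_wpM2l.
Qed.

(** Each term is at most C N(t) / W(t) with t = 2^(k+1) r, which by doubling is
    at most C times the Morrey norm times the term c (k.+1) of the dyadic sum. *)
Lemma size_series_le : exists2 A : R, (0 < A)%R &
  forall (f : V -> R) (X : R) (a : V) (r : R), measurable_fun setT f ->
    (0 <= X)%R -> Morrey p w1p psi1 (EFin \o f) = X%:E -> (0 < r)%R ->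
    \sum_(1 <= k <oo)
      (((2 ^+ k.+1 * r) `^ (- (n%:R / s) + alpha))%:E *
       (\int[mu]_(y in eball a (2 ^+ k.+1 * r)) (`|f y| `^ s)%:E) `^ s^-1) <=
    (A * (X * psi2 a r))%:E.
Proof.
have [K K0 HK] := Lnormw_dyadic_le.
have [D D0 HD] := ball_weight_doubling.
have [K1 K10 HK1] := Apq_hoelder_scale.
exists (K1 * D * K)%R; first by rewrite !mulr_gt0.
move=> f X a r mf X0 XE r0.
have [c [c0 csum cN]] := HK f X a r mf X0 XE r0.
have e0 k : (0 < 2 ^+ k * r)%R by rewrite mulr_gt0// exprn_gt0.
pose b (k : nat) := ((2 ^+ k.+1 * r) `^ (- (n%:R / s) + alpha))%:E *
  (\int[mu]_(y in eball a (2 ^+ k.+1 * r)) (`|f y| `^ s)%:E) `^ s^-1.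
change (\sum_(1 <= k <oo) b k <= (K1 * D * K * (X * psi2 a r))%:E).
have b0 k : 0 <= b k.
  by apply: mule_ge0; [rewrite lee_fin powR_ge0|exact: poweR_ge0].
have bc k : b k <= (K1 * D * X * c k.+1)%:E.
  have Wk := ball_weight_gt0 a (e0 k.+1).
  have : b k * (W a (2 ^+ k.+1 * r))%:E <=
      (K1 * (X * (c k.+1 * W a (2 ^+ k.+2 * r))))%:E.
    apply: (le_trans (HK1 a _ f (e0 k.+1) mf)); rewrite EFinM.
    by apply: lee_wpmul2l; [rewrite lee_fin ltW|exact: cN].
  rewrite -lee_pdivlMr// => /le_trans; apply; rewrite -EFinM lee_fin.
  rewrite ler_pdivrMr//.
  have Wk2 : (W a (2 ^+ k.+2 * r) <= D * W a (2 ^+ k.+1 * r))%R.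
    by rewrite exprS -mulrA; apply: HD.
  have KXc : (0 <= K1 * X * c k.+1)%R by apply: mulr_ge0 => //; apply: mulr_ge0 => //; exact: ltW.
  have := ler_wpM2l KXc Wk2; congr (_ <= _)%R; by ring.
apply: lime_le; first by apply: is_cvg_nneseries.
apply: nearW => N.
apply: (@le_trans _ _ (\sum_(1 <= k < N) (K1 * D * X * c k.+1)%:E)).
  by apply: lee_sum.
rewrite sumEFin lee_fin -mulr_sumr.
rewrite (_ : (K1 * D * K * _ = K1 * D * X * (K * psi2 a r))%R); last by ring.
apply: ler_wpM2l.
  by apply: mulr_ge0 => //; apply: mulr_ge0; exact: ltW.
apply: le_trans (csum N.+1).
rewrite -[leLHS](big_add1 _ _ _ N.+1 xpredT c).
exact: ler_sum_nat_drop.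
Qed.

End setting.

(** * Boundedness at a fixed time *)

Section slice.
Context {R : realType} {n : nat}.
Local Notation V := (Rn R n).
Local Notation mu := (@leb R n).
Hypothesis n0 : (0 < n)%N.
Local Open Scope ereal_scope.
Variables (w1 w2 : V -> R) (s p q alpha : R) (psi1 psi2 : V -> R -> R).
Hypotheses (hw1 : weight w1) (hw2 : weight w2).
Hypotheses (s0 : (0 < s)%R) (sp : (s <= p)%R) (pq : (p < q)%R).
Hypothesis hq : (q^-1 = p^-1 - alpha / n%:R)%R.
Hypothesis hA12 : Apq (p / s) (q / s) (fun x => w1 x `^ s)%R (fun x => w2 x `^ s)%R.
Hypothesis hA2 : Apq (p / s) (q / s) (fun x => w2 x `^ s)%R (fun x => w2 x `^ s)%R.
Hypothesis hpsi1 : forall (a : V) (r : R), (0 < r)%R -> (0 < psi1 a r)%R.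
Hypothesis hpsi2 : forall (a : V) (r : R), (0 < r)%R -> (0 < psi2 a r)%R.
Hypothesis hpsi12 : psi_condition p q w1 w2 psi1 psi2.
Local Notation w1p := (fun x => w1 x `^ p)%R.
Local Notation w2q := (fun x => w2 x `^ q)%R.

Lemma Morrey_ge0 (f : V -> \bar R) : 0 <= Morrey p w1p psi1 f.
Proof.
pose a : V := [tuple of nseq n 0%R].
apply: (@le_trans _ _ ((psi1 a 1)^-1%:E * (wmeasure w1p (eball a 1) `^ p^-1)^-1 *
    Lnormw p w1p (eball a 1) f)).
  apply: mule_ge0; last exact: poweR_ge0.
  apply: mule_ge0; first by rewrite lee_fin invr_ge0 ltW// hpsi1.
  by rewrite inve_ge0; exact: poweR_ge0.
by apply: ereal_sup_ubound; exists a => //; exists 1%R => /=.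
Qed.

Lemma Lnormw_indic (f : V -> R) (E : set V) : (p != 0)%R ->
  Lnormw p w1p setT (EFin \o (f \* \1_E)%R) = Lnormw p w1p E (EFin \o f).
Proof.
move=> pn0; have I := integral_powR_indic mu setT E f w1p pn0.
by rewrite setTI in I; exact: (congr1 (fun z => z `^ p^-1) I).
Qed.

Variables (S : (V -> R) -> V -> \bar R) (Z : set V -> (V -> \bar R) -> \bar R).
Hypothesis hSm : measurable_op S.
Hypothesis hS : sublinear S.
Hypothesis hsize : size_condition S alpha s.
Hypothesis Zsplit : forall (a : V) (r : R) (h h1 : V -> \bar R) (M : R),
  (0 < r)%R -> (0 <= M)%R -> measurable_fun setT h -> measurable_fun setT h1 ->
  {ae mu, forall x, eball a r x -> `|h x| <= `|h1 x| + M%:E} ->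
  Z (eball a r) h <=
    4%:E * (Z setT h1 + M%:E * wmeasure w2q (eball a r) `^ q^-1).
Hypothesis Zbounded : bounded_op S (Lnormw p w1p setT) (Z setT).

Lemma mul_indic_split (f : V -> R) (E : set V) :
  f = ((f \* \1_E) \+ (f \* \1_(~` E)))%R.
Proof.
apply/funext => x /=; rewrite !indicE in_setC.
by case: (x \in E); rewrite mulr1 mulr0 ?addr0 ?add0r.
Qed.

(** Stated for a family Z E of functionals, to be the strong or the weak weighted
    norm on E, about which only two facts are used: the boundedness of S and the
    compatibility with a splitting |h| <= |h1| + M on a ball. *)
Lemma slice_bounded : exists2 C : R, (0 < C)%R &
  forall f : V -> R, measurable_fun setT f ->
    ereal_sup [set (psi2 a r)^-1%:E *
                   (wmeasure w2q (eball a r) `^ q^-1)^-1 * Z (eball a r) (S f)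
              | a in setT & r in [set r : R | (0 < r)%R]]
    <= C%:E * Morrey p w1p psi1 (EFin \o f).
Proof.
have p0 : (0 < p)%R by exact: lt_le_trans sp.
have [A1 A10 HA1] := Lnormw_local_le n0 hw1 hw2 s0 sp pq hA12 hA2 hpsi1 hpsi2 hpsi12.
have [A2 A20 HA2] := size_series_le n0 hw1 hw2 s0 sp pq hq hA12 hA2 hpsi1 hpsi2 hpsi12.
have [Cb Cb0 HCb] := Zbounded.
have [Cs Cs0 HCs] := hsize.
have [Sadd _] := hS.
have C0 : (0 < 4 * (Cb * A1 + Cs * A2))%R by rewrite mulr_gt0// addr_gt0// mulr_gt0.
exists (4 * (Cb * A1 + Cs * A2))%R => // f mf.
have := Morrey_ge0 (EFin \o f); have := HA2 f; have := HA1 f.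
set MX := Morrey _ _ _ _ => {}HA1 {}HA2 MX0.
have [->|MXoo] := eqVneq MX +oo; first by rewrite gt0_muley ?leey.
have MXE : MX = (fine MX)%:E by rewrite fineK// ge0_fin_numE// ltey.
have X0 : (0 <= fine MX)%R by rewrite -lee_fin -MXE.
apply: ge_ereal_sup => _ [a _ [r /= r0 <-]].
have {HA1} := HA1 _ a r mf X0 MXE r0.
have {HA2} := HA2 _ a r mf X0 MXE r0.
rewrite MXE; move: (fine MX) X0 => X X0 {MX MX0 MXoo MXE} far loc.
have W0 := ball_weight_gt0 n0 hw1 hw2 s0 sp pq hA12 a r0.
have WE := ball_weightE n0 hw1 s0 sp pq hA12 a r0.
have psi20 := hpsi2 a r0.
have mB := measurable_eball a (2 * r).
pose f1 := (f \* \1_(eball a (2 * r)))%R.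
pose f2 := (f \* \1_(~` eball a (2 * r)))%R.
have mf1 : measurable_fun setT f1.
  exact: (measurable_funM mf (measurable_indic mB)).
have mf2 : measurable_fun setT f2.
  exact: (measurable_funM mf (measurable_indic (measurableC mB))).
rewrite -Lnormw_indic ?gt_eqF// -/f1 in loc.
have {}loc : Z setT (S f1) <= (Cb * (A1 * (X * (psi2 a r * ball_weight w2 q a r))))%:E.
  apply: (le_trans (HCb f1 mf1 (le_lt_trans loc (ltry _)))); rewrite EFinM.
  by apply: lee_wpmul2l loc; rewrite lee_fin ltW.
pose M := (Cs * (A2 * (X * psi2 a r)))%R.
have M0 : (0 <= M)%R.
  by apply: mulr_ge0; [exact: ltW|apply: mulr_ge0; [exact: ltW|apply: mulr_ge0 => //; exact: ltW]].
have {}far x : eball a r x -> `|S f2 x| <= M%:E.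
  move=> Bx; apply: (@le_trans _ _ (ereal_sup [set `|S f2 x| | x in eball a r])).
    by apply: ereal_sup_ubound; exists x.
  apply: (le_trans (HCs f a r mf r0)); rewrite EFinM.
  by apply: lee_wpmul2l far; rewrite lee_fin ltW.
have Sae : {ae mu, forall x, eball a r x -> `|S f x| <= `|S f1 x| + M%:E}.
  have := Sadd f1 f2 mf1 mf2; rewrite -mul_indic_split; apply: filterS => x Sx Bx.
  by apply: (le_trans Sx); apply: leeD2l; exact: far.
have := Zsplit r0 M0 (hSm mf) (hSm mf1) Sae.
rewrite WE => ZS; rewrite inver gt_eqF// -EFinM -invfM lee_pdivrMl ?mulr_gt0//.
apply: (le_trans ZS).
apply: le_trans (lee_wpmul2l _ (leeD2r _ loc)) _; first by rewrite lee_fin.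
rewrite -!EFinM lee_fin /M le_eqVlt; apply/orP; left; apply/eqP.
by ring.
Qed.

End slice.

(** * Strong and weak norms under a bounded perturbation *)

Section split.
Context d (X : measurableType d) (R : realType).
Variable mu : {measure set X -> \bar R}.
Local Open Scope ereal_scope.
Variable w : X -> R.
Hypotheses (mw : measurable_fun setT w) (w0 : forall x, (0 <= w x)%R).

(** The sum is at most twice the larger of the two terms. *)
Lemma poweR_add_le (q : R) (y1 y2 z : \bar R) : (0 <= q)%R ->
  0 <= y1 -> 0 <= y2 -> 0 <= z -> z <= y1 + y2 ->
  z `^ q <= (2 `^ q)%:E * (y1 `^ q + y2 `^ q).
Proof.
move=> q0; wlog y12 : y1 y2 / y1 <= y2 => [wlg y10 y20 z0 zy|y10 y20 z0 zy].
  have [y12|/ltW y21] := leP y1 y2; first exact: wlg.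
  by rewrite addeC; apply: wlg => //; rewrite addeC.
have two : y2 + y2 = 2%:E * y2.
  by rewrite -[2%R]/(1 + 1)%R EFinD ge0_muleDl ?mul1e.
apply: (@le_trans _ _ ((2%:E * y2) `^ q)).
  by apply: lee_poweR => //; rewrite -two (le_trans zy)// leeD2r.
rewrite poweRM// poweR_EFin; apply: lee_wpmul2l.
  by rewrite lee_fin powR_ge0.
by rewrite leeDr ?poweR_ge0.
Qed.

(** Replaces Minkowski's inequality at the cost of the constant 4: a factor 2 comes
    from |h|^q <= 2^q (|h1|^q + M^q), another one from the root of order q of a
    sum, where q >= 1 gives 2^(1/q) <= 2. *)
Lemma integral_norm_split (D : set X) (q M : R) (h h1 : X -> \bar R) :
  measurable D -> (1 <= q)%R -> (0 <= M)%R -> measurable_fun setT h1 ->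
  {ae mu, forall x, D x -> `|h x| <= `|h1 x| + M%:E} ->
  (\int[mu]_(x in D) (`|h x| `^ q * (w x)%:E)) `^ q^-1 <=
  4%:E * ((\int[mu]_(x in setT) (`|h1 x| `^ q * (w x)%:E)) `^ q^-1 +
          M%:E * (\int[mu]_(x in D) (w x)%:E) `^ q^-1).
Proof.
move=> mD q1 M0 mh1 hh1.
have q0 : (0 < q)%R by exact: lt_le_trans q1.
have qn0 : (q != 0)%R by rewrite gt_eqF.
have q'0 : (0 <= q^-1)%R by rewrite invr_ge0 ltW.
have q20 : (0 < 2 `^ q :> R)%R by exact: powR_gt0.
have mh1w : measurable_fun setT (fun x => `|h1 x| `^ q * (w x)%:E).
  apply: emeasurable_funM; first exact: measurableT_comp (measurable_poweR q) (measurableT_comp (@abse_measurable R setT) mh1).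
  exact/measurable_EFinP.
have ge0w (f : X -> \bar R) x : 0 <= `|f x| `^ q * (w x)%:E.
  by rewrite mule_ge0 ?poweR_ge0// lee_fin.
set I := \int[mu]_(x in D) _.
set I1 := \int[mu]_(x in setT) _.
set W := \int[mu]_(x in D) (w x)%:E.
have I0 : 0 <= I by apply: integral_ge0.
have I10 : 0 <= I1 by apply: integral_ge0.
have W0 : 0 <= W by apply: integral_ge0 => x _; rewrite lee_fin.
have IW : I <= (2 `^ q)%:E * (I1 + (M `^ q)%:E * W).
  apply: (@le_trans _ _ (\int[mu]_(x in D)
    ((2 `^ q)%:E * (`|h1 x| `^ q * (w x)%:E + (M `^ q * w x)%:E)))).
    apply: ge0_le_integral_ae => //.
    - move=> x _; rewrite mule_ge0 ?lee_fin ?powR_ge0// adde_ge0//.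
      by rewrite lee_fin mulr_ge0// powR_ge0.
    - apply: filterS hh1 => x hx Dx.
      rewrite EFinM -ge0_muleDl ?poweR_ge0 ?lee_fin ?powR_ge0// muleA.
      apply: lee_wpmul2r; first by rewrite lee_fin.
      rewrite -[(M `^ q)%:E]poweR_EFin.
      by apply: poweR_add_le; [exact: ltW| | | |exact: hx].
  apply: le_trans (ge0_integralZl_le _ q20 _) _.
    by move=> x _; rewrite adde_ge0// lee_fin mulr_ge0// powR_ge0.
  apply: lee_wpmul2l; first by rewrite lee_fin ltW.
  rewrite ge0_integralD//; first last.
  - by apply: measurable_funTS; apply/measurable_EFinP; exact: measurable_funM.
  - by move=> x _; rewrite lee_fin mulr_ge0// powR_ge0.
  - exact: measurable_funTS.
  apply: leeD; first exact: ge0_subset_integral.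
  under eq_integral do rewrite EFinM.
  rewrite ge0_integralZl_EFin ?powR_ge0//.
    by move=> x _; rewrite lee_fin.
  by apply: measurable_funTS; exact/measurable_EFinP.
have B0 : 0 <= (M `^ q)%:E * W by rewrite mule_ge0// lee_fin powR_ge0.
apply: (le_trans (lee_poweR q'0 I0 IW)).
rewrite (poweRM _ _ (adde_ge0 I10 B0)) ?lee_fin ?powR_ge0// poweR_EFin -powRrM divff// powRr1//.
have -> : M%:E * W `^ q^-1 = ((M `^ q)%:E * W) `^ q^-1.
  by rewrite poweRM ?lee_fin ?powR_ge0// poweR_EFin -powRrM divff// powRr1.
have := poweR_add_le q'0 I10 B0 (adde_ge0 I10 B0) (lexx _).
set Y := _ `^ _ + _ `^ _ => H.
have Y0 : 0 <= Y by rewrite adde_ge0 ?poweR_ge0.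
have two_root : (2 `^ q^-1 <= 2 :> R)%R.
  rewrite -[leRHS]powRr1//; apply: ler_powR; first by rewrite ler1n.
  by rewrite invf_le1.
apply: (@le_trans _ _ (2%:E * (2%:E * Y))); last first.
  by rewrite muleA -EFinM -natrM.
apply: lee_wpmul2l => //; apply: (le_trans H); apply: lee_wpmul2r => //.
Qed.

(** If c <= 2 M, the level set is bounded by the whole of D. If c > 2 M, then
    c < |h1| + M forces |h1| > c / 2. *)
Lemma weak_norm_split (D : set X) (q M c : R) (h h1 : X -> \bar R) :
  measurable D -> (0 < q)%R -> (0 <= M)%R -> (0 < c)%R ->
  {ae mu, forall x, D x -> `|h x| <= `|h1 x| + M%:E} ->
  c%:E * (\int[mu]_(x in [set x | D x /\ c%:E < `|h x|]) (w x)%:E) `^ q^-1 <=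
  2%:E * ((c / 2)%:E *
    (\int[mu]_(x in [set x | setT x /\ (c / 2)%:E < `|h1 x|]) (w x)%:E) `^ q^-1 +
    M%:E * (\int[mu]_(x in D) (w x)%:E) `^ q^-1).
Proof.
move=> mD q0 M0 c0 hh1.
have q'0 : (0 <= q^-1)%R by rewrite invr_ge0 ltW.
have Wge0 (A : set X) : 0 <= \int[mu]_(x in A) (w x)%:E.
  by apply: integral_ge0 => x _; rewrite lee_fin.
have mono (A B : set X) : {ae mu, forall x, A x -> B x} ->
    \int[mu]_(x in A) (w x)%:E <= \int[mu]_(x in B) (w x)%:E.
  move=> AB; rewrite integral_mkcond [leRHS]integral_mkcond.
  apply: ge0_le_integral_ae => [x _|x _|].
  - by rewrite patchE; case: ifP; rewrite ?lee_fin.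
  - by rewrite patchE; case: ifP; rewrite ?lee_fin.
  apply: filterS AB => x AB _; rewrite !patchE; case: ifPn => [|_].
    by rewrite inE => /AB Bx; rewrite mem_set.
  by case: ifP; rewrite ?lee_fin.
have [cM|Mc] := leP c (2 * M)%R.
  apply: (@le_trans _ _ (2%:E * (M%:E * (\int[mu]_(x in D) (w x)%:E) `^ q^-1))).
    rewrite muleA -EFinM; apply: lee_pmul; rewrite ?lee_fin ?poweR_ge0 ?(ltW c0)//.
    apply: lee_poweR => //; apply: mono; apply: aeW => x [].
    by [].
  apply: lee_wpmul2l => //; rewrite leeDr// mule_ge0 ?poweR_ge0// lee_fin.
  by rewrite divr_ge0// ltW.
apply: (@le_trans _ _ (2%:E * ((c / 2)%:E *
    (\int[mu]_(x in [set x | setT x /\ (c / 2)%:E < `|h1 x|]) (w x)%:E) `^ q^-1))).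
  rewrite muleA -EFinM mulrC divfK//; apply: lee_wpmul2l; first by rewrite lee_fin ltW.
  apply: lee_poweR => //; apply: mono; apply: filterS hh1 => x hx [Dx ch]; split => //.
  have := lt_le_trans ch (hx Dx); case: (`|h1 x|) => [y| |]//=.
    by rewrite -EFinD !lte_fin => cy; lra.
  by move=> _; rewrite ltry.
apply: lee_wpmul2l => //; rewrite leeDl// mule_ge0 ?poweR_ge0// lee_fin.
Qed.

End split.

Section weak.
Context {R : realType} {n : nat}.
Local Notation V := (Rn R n).
Local Open Scope ereal_scope.

Lemma WLnormw_ge0 (q : R) (w : V -> R) (E : set V) (f : V -> \bar R) :
  0 <= WLnormw q w E f.
Proof.
apply: (@le_trans _ _ (1%:E * wmeasure w [set x | E x /\ 1%:E < `|f x|] `^ q^-1)).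
  by rewrite mul1e poweR_ge0.
by apply: ereal_sup_ubound; exists 1%R => /=.
Qed.

Lemma WMorrey_ge0 (q : R) (w : V -> R) (psi : V -> R -> R) (f : V -> \bar R) :
  (forall (a : V) (r : R), (0 < r)%R -> (0 < psi a r)%R) -> 0 <= WMorrey q w psi f.
Proof.
move=> psi0; pose a : V := [tuple of nseq n 0%R].
apply: (@le_trans _ _ ((psi a 1)^-1%:E * (wmeasure w (eball a 1) `^ q^-1)^-1 *
    WLnormw q w (eball a 1) f)).
  apply: mule_ge0; last exact: WLnormw_ge0.
  apply: mule_ge0; first by rewrite lee_fin invr_ge0 ltW// psi0.
  by rewrite inve_ge0; exact: poweR_ge0.
by apply: ereal_sup_ubound; exists a => //; exists 1%R => /=.
Qed.

Variable w : V -> R.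
Hypotheses (mw : measurable_fun setT w) (w0 : forall x, (0 <= w x)%R).

Lemma Lnormw_split (q M : R) (a : V) (r : R) (h h1 : V -> \bar R) :
  (1 <= q)%R -> (0 <= M)%R -> measurable_fun setT h1 ->
  {ae leb n, forall x, eball a r x -> `|h x| <= `|h1 x| + M%:E} ->
  Lnormw q w (eball a r) h <=
    4%:E * (Lnormw q w setT h1 + M%:E * wmeasure w (eball a r) `^ q^-1).
Proof.
move=> q1 M0 mh1 hh1.
exact: (integral_norm_split mw w0 (measurable_eball a r) q1 M0 mh1 hh1).
Qed.

Lemma WLnormw_split (q M : R) (a : V) (r : R) (h h1 : V -> \bar R) :
  (0 < q)%R -> (0 <= M)%R ->
  {ae leb n, forall x, eball a r x -> `|h x| <= `|h1 x| + M%:E} ->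
  WLnormw q w (eball a r) h <=
    4%:E * (WLnormw q w setT h1 + M%:E * wmeasure w (eball a r) `^ q^-1).
Proof.
move=> q0 M0 hh1; apply: ge_ereal_sup => _ [c /= c0 <-].
apply: (le_trans (weak_norm_split w0 (measurable_eball a r) q0 M0 c0 hh1)).
have W0 : 0 <= wmeasure w (eball a r) `^ q^-1 by exact: poweR_ge0.
apply: lee_pmul.
- by [].
- apply: adde_ge0; apply: mule_ge0; rewrite ?poweR_ge0// lee_fin// divr_ge0//.
  exact: ltW.
- by rewrite lee_fin ler_nat.
apply: leeD2r; apply: ereal_sup_ubound; exists (c / 2)%R => //=.
by rewrite divr_gt0.
Qed.

End weak.
(** * Integration over time *)

Section time.
Context {R : realType} {n : nat}.
Local Notation V := (Rn R n).
Local Open Scope ereal_scope.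

(** The bound at a fixed time holds for almost every t, so it survives the
    integration in t; the factors that depend on the ball (a, r) are common to
    both sides. No measurability in t is available, hence the two lemmas on
    arbitrary nonnegative functions. *)
Lemma time_bounded_of_slice (S : (V -> R) -> V -> \bar R) (p C T : R)
    (w : V -> R) (psi : V -> R -> R) (XX YY : (V -> \bar R) -> \bar R) :
  (0 < p)%R -> (0 < C)%R ->
  (forall (a : V) (r : R), (0 < r)%R -> (0 < psi a r)%R) ->
  (forall f, 0 <= XX f) -> (forall f, 0 <= YY f) ->
  (forall f : V -> R, measurable_fun setT f -> YY (S f) <= C%:E * XX (EFin \o f)) ->
  time_bounded_op S p w psi T XX YY.
Proof.
move=> p0 C0 psi0 X0 Y0 slice; exists C => // f mf _.
apply: ge_ereal_sup => _ [a [r [t0 [r0 t0T ->]]]].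
set D := (_ `&` _).
set A := (psi a r)^-1%:E * _.
have A0 : 0 <= A.
  apply: mule_ge0; first by rewrite lee_fin invr_ge0 ltW// psi0.
  by rewrite inve_ge0 poweR_ge0.
apply: (@le_trans _ _ (C%:E * (A *
  (\int[lebesgue_measure]_(t in D) XX (fun x => (f x t)%:E) `^ p) `^ p^-1))); last first.
  apply: lee_wpmul2l; first by rewrite lee_fin ltW.
  by apply: ereal_sup_ubound; exists a, r, t0.
rewrite muleCA; apply: lee_wpmul2l => //.
set J := \int[lebesgue_measure]_(t in D) XX (fun x => (f x t)%:E) `^ p.
have J0 : 0 <= J by apply: integral_ge0 => t _; exact: poweR_ge0.
have Cp : (0 < C `^ p)%R by exact: powR_gt0.
have -> : C%:E * J `^ p^-1 = ((C `^ p)%:E * J) `^ p^-1.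
  rewrite poweRM ?lee_fin ?(ltW Cp)// poweR_EFin -powRrM divff ?gt_eqF// powRr1//.
  exact: ltW.
apply: lee_poweR; first by rewrite invr_ge0 ltW.
  by apply: integral_ge0 => t _; exact: poweR_ge0.
apply: le_trans (ge0_integralZl_le _ Cp _); last by move=> t _; exact: poweR_ge0.
apply: ge0_le_integral_ae.
- by move=> t _; exact: poweR_ge0.
- by move=> t _; rewrite mule_ge0 ?poweR_ge0// lee_fin ltW.
have [N [mN N0 Nmf]] := mf; exists N; split => // t /= tN; apply: Nmf => mft.
apply: tN => -[] /=; rewrite in_itv/= => /mft mf' _.
rewrite -poweR_EFin -poweRM ?lee_fin ?(ltW C0)//.
by apply: lee_poweR (slice _ mf'); [exact: ltW|exact: Y0].
Qed.

End time.

Unset Implicit Arguments.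
Set Strict Implicit.

Theorem theorem1p4 (R : realType) (n : nat) (T : R) (psi : Rn R n -> R -> R)
  (w : Rn R n -> R) (p0 alpha p q s : R) (w1 w2 : Rn R n -> R)
  (S : (Rn R n -> R) -> Rn R n -> \bar R) (psi1 psi2 : Rn R n -> R -> R)
  (hT : 0 < T)
  (hpsi : forall (a : Rn R n) (r : R), 0 < r -> 0 < psi a r)
  (hw : weight w)
  (hp0 : 1 <= p0)
  (halpha : 0 < alpha < n%:R)
  (hp : 1 <= p < n%:R / alpha)
  (hq : q^-1 = p^-1 - alpha / n%:R)
  (hs : 1 < p -> 1 <= s < p)
  (hs1 : p = 1 -> s = 1)
  (hw1 : weight w1) (hw2 : weight w2)
  (hA12 : Apq (p / s) (q / s) (fun x => w1 x `^ s) (fun x => w2 x `^ s))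
  (hA2 : Apq (p / s) (q / s) (fun x => w2 x `^ s) (fun x => w2 x `^ s))
  (hSm : measurable_op S)
  (hS : sublinear S)
  (hsize : size_condition S alpha s)
  (hpsi1 : forall (a : Rn R n) (r : R), 0 < r -> 0 < psi1 a r)
  (hpsi2 : forall (a : Rn R n) (r : R), 0 < r -> 0 < psi2 a r)
  (hpsi12 : psi_condition p q w1 w2 psi1 psi2) :
  let w1p := fun x => w1 x `^ p in
  let w2q := fun x => w2 x `^ q in
  (1 < p ->
   bounded_op S (Lnormw p w1p setT) (Lnormw q w2q setT) ->
   time_bounded_op S p0 w psi T (Morrey p w1p psi1) (Morrey q w2q psi2)) /\
  (p = 1 ->
   bounded_op S (Lnormw 1 w1 setT) (WLnormw q w2q setT) ->
   time_bounded_op S p0 w psi T (Morrey 1 w1 psi1) (WMorrey q w2q psi2)).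
Proof.
move=> w1p w2q.
have [alpha0 alphan] := andP halpha.
have [p1 pna] := andP hp.
have nR0 : 0 < n%:R :> R by exact: lt_trans alphan.
have n0 : (0 < n)%N by rewrite -(ltr0n R).
have pgt0 : 0 < p by exact: lt_le_trans p1.
have an0 : 0 < alpha / n%:R by rewrite divr_gt0.
have qV0 : 0 < q^-1.
  by rewrite hq subr_gt0 -invf_div ltf_pV2 ?posrE// divr_gt0.
have q0 : 0 < q by rewrite -invr_gt0.
have pq : p < q by rewrite -ltf_pV2 ?posrE// hq ltrBlDr ltrDl.
have q1 : 1 <= q by exact: le_trans (ltW pq).
have [s0 sp] : 0 < s /\ s <= p.
  move: p1; rewrite le_eqVlt => /orP[/eqP p1|/hs/andP[s1 sp]].
    by rewrite (hs1 (esym p1)) -p1.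
  by split; [exact: lt_le_trans s1|exact: ltW].
have [mw2 w20 _ _] := hw2; have [_ w10 _ _] := hw1.
have mw2q : measurable_fun setT w2q by exact: measurable_fun_powR.
have w2q0 x : 0 <= w2q x by exact: powR_ge0.
have p00 : 0 < p0 by exact: lt_le_trans hp0.
split => [_|pE] Sbnd.
- have Zsplit (a : Rn R n) (r : R) h h1 (M : R) (_ : 0 < r) (M0 : 0 <= M)
      (_ : measurable_fun setT h) mh1 hh1 :=
    Lnormw_split mw2q w2q0 (a := a) (r := r) (h := h) (h1 := h1) q1 M0 mh1 hh1.
  have [C C0 HC] := slice_bounded n0 hw1 hw2 s0 sp pq hq hA12 hA2 hpsi1 hpsi2 hpsi12
    hSm hS hsize Zsplit Sbnd.
  apply: (time_bounded_of_slice _ _ p00 C0 hpsi) => f.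
  + exact: Morrey_ge0.
  + exact: Morrey_ge0.
  + exact: HC.
have w1E : Morrey 1 w1 psi1 = Morrey p w1p psi1.
  by rewrite pE; congr Morrey; apply/funext => x; rewrite /w1p pE powRr1.
have L1E : Lnormw 1 w1 setT = Lnormw p w1p setT.
  by rewrite pE; congr Lnormw; apply/funext => x; rewrite /w1p pE powRr1.
rewrite w1E; rewrite L1E in Sbnd.
have Zsplit (a : Rn R n) (r : R) h h1 (M : R) (_ : 0 < r) (M0 : 0 <= M)
    (_ : measurable_fun setT h) (_ : measurable_fun setT h1) hh1 :=
  WLnormw_split w2q0 (a := a) (r := r) (h := h) (h1 := h1) q0 M0 hh1.
have [C C0 HC] := slice_bounded n0 hw1 hw2 s0 sp pq hq hA12 hA2 hpsi1 hpsi2 hpsi12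
  hSm hS hsize Zsplit Sbnd.
apply: (time_bounded_of_slice _ _ p00 C0 hpsi) => f.
- exact: Morrey_ge0.
- exact: WMorrey_ge0.
- exact: HC.
Qed.
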